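(* Let $\mathfrak{H}$ be a separable Hilbert space with an orthogonal decomposition $\mathfrak{H}=\mathfrak{H}_0\oplus\mathfrak{H}_1$, let $A_0$, $A_1$ be bounded self-adjoint operators on $\mathfrak{H}_0$, $\mathfrak{H}_1$ respectively, let $V:\mathfrak{H}_1\to\mathfrak{H}_0$ be a bounded operator, and let $\lambda\in\mathbb{R}$ satisfy $\sup\mathrm{spec}(A_0)\le\lambda\le\inf\mathrm{spec}(A_1)$. Put $\mathbf{B}=\begin{pmatrix}A_0&V\\ V^*&A_1\end{pmatrix}$. A contractive solution $X:\mathfrak{H}_0\to\mathfrak{H}_1$ to the Riccati equation $$A_1X-XA_0-XVX+V^*=0$$ is the unique contractive solution if and only if the graph $\mathcal{G}(\mathfrak{H}_0,X)$ is a spectral subspace of the operator $\mathbf{B}$ and $\mu=1$ is not an eigenvalue of $|X|=(X^*X)^{1/2}$. In this case, $X$ is a strict contraction and $$\text{either}\quad \mathrm{Ran}\,\mathsf{E}_{\mathbf{B}}((-\infty,\lambda))=\mathcal{G}(\mathfrak{H}_0,X)\quad\text{or}\quad \mathrm{Ran}\,\mathsf{E}_{\mathbf{B}}((\lambda,+\infty))=\mathcal{G}(\mathfrak{H}_1,-X^* ).$$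
   Context: $\mathrm{spec}(T)$ denotes the spectrum of $T$, and $\mathsf{E}_{\mathbf{B}}(\Delta)$ the spectral projection of the self-adjoint operator $\mathbf{B}$ for the Borel set $\Delta\subset\mathbb{R}$. A spectral subspace of $\mathbf{B}$ is a subspace of the form $\mathrm{Ran}\,\mathsf{E}_{\mathbf{B}}(\Delta)$ with $\Delta\subset\mathbb{R}$ Borel. A contractive solution is a bounded operator $X:\mathfrak{H}_0\to\mathfrak{H}_1$ with $\|X\|\le1$ satisfying the Riccati equation; $X$ is a strict contraction if $\|Xf\|<\|f\|$ for all $f\ne0$. Graphs: $\mathcal{G}(\mathfrak{H}_0,X)=\{x\oplus Xx\mid x\in\mathfrak{H}_0\}$ and $\mathcal{G}(\mathfrak{H}_1,-X^* )=\{(-X^*y)\oplus y\mid y\in\mathfrak{H}_1\}$, both subspaces of $\mathfrak{H}=\mathfrak{H}_0\oplus\mathfrak{H}_1$. *)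

(* Defs.v *)
From HB Require Import structures.
From mathcomp Require Import all_boot all_order all_algebra.
From mathcomp Require Import complex ring.
From mathcomp Require Import all_classical all_reals all_analysis.

Set Implicit Arguments.
Unset Strict Implicit.
Unset Printing Implicit Defensive.

Import Order.TTheory GRing.Theory Num.Theory.
Import numFieldNormedType.Exports.

Local Open Scope classical_set_scope.
Local Open Scope ring_scope.
Local Open Scope complex_scope.

(* Complex Hilbert spaces; the inner product is linear in the first argument. *)
HB.mixin Record NormedModule_isHilbert (R : realType) H
    & NormedModule R[i] H := {
  inner : H -> H -> R[i];
  innerPl : forall (a : R[i]) (x y z : H),
    inner (a *: x + y) z = a * inner x z + inner y z;
  inner_conj : forall x y : H, inner y x = (inner x y)^*;
  inner_norm : forall x : H, inner x x = `|x| ^+ 2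
}.

#[short(type="hilbertType")]
HB.structure Definition Hilbert (R : realType) :=
  {H of CompleteNormedModule R[i] H & NormedModule_isHilbert R H}.

(* The orthogonal direct sum: H0 * H1 with the l2 norm (the normed structure
   that the library puts on H0 * H1 is the sup norm, hence the alias). *)
Definition hsum (R : realType) (H0 H1 : hilbertType R) : Type := (H0 * H1)%type.

Section DirectSum.
Variables (R : realType) (H0 H1 : hilbertType R).
Local Notation H := (hsum H0 H1).

HB.instance Definition _ := GRing.Lmodule.copy H (H0 * H1)%type.

Definition hsum_norm (z : H) : R[i] := sqrtC (`|z.1| ^+ 2 + `|z.2| ^+ 2).

Lemma hsum_norm_ge0 z : 0 <= hsum_norm z.
Proof. by rewrite sqrtC_ge0 addr_ge0 ?exprn_ge0. Qed.

Lemma hsum_norm_sqr z : hsum_norm z ^+ 2 = `|z.1| ^+ 2 + `|z.2| ^+ 2.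
Proof. exact: sqrtCK. Qed.

Lemma hsum_normD x y : hsum_norm (x + y) <= hsum_norm x + hsum_norm y.
Proof.
suff minkowski (a b c d : R[i]) : 0 <= a -> 0 <= b -> 0 <= c -> 0 <= d ->
    sqrtC ((a + c) ^+ 2 + (b + d) ^+ 2) <=
    sqrtC (a ^+ 2 + b ^+ 2) + sqrtC (c ^+ 2 + d ^+ 2).
  apply: le_trans (minkowski `|x.1| `|x.2| `|y.1| `|y.2| _ _ _ _) => //.
  rewrite ler_sqrtC ?nnegrE ?addr_ge0 ?exprn_ge0 ?addr_ge0//.
  by rewrite lerD// lerXn2r ?nnegrE ?addr_ge0// ler_normD.
move=> a0 b0 c0 d0.
have sq_ge0 (u v : R[i]) : 0 <= u -> 0 <= v -> 0 <= u ^+ 2 + v ^+ 2.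
  by move=> u0 v0; rewrite addr_ge0 ?exprn_ge0.
rewrite -(@ler_pXn2r _ 2)// ?nnegrE ?addr_ge0 ?sqrtC_ge0 ?sq_ge0 ?addr_ge0//.
rewrite [leRHS]sqrrD !sqrtCK.
have -> : (a + c) ^+ 2 + (b + d) ^+ 2 =
    a ^+ 2 + b ^+ 2 + (a * c + b * d) *+ 2 + (c ^+ 2 + d ^+ 2).
  by rewrite !sqrrD; ring.
rewrite lerD2r lerD2l lerMn2r/= -sqrtCM ?nnegrE ?sq_ge0//.
rewrite -(@ler_pXn2r _ 2)// ?nnegrE ?sqrtC_ge0 ?addr_ge0 ?mulr_ge0 ?sq_ge0//.
rewrite sqrtCK -subr_ge0.
have -> : (a ^+ 2 + b ^+ 2) * (c ^+ 2 + d ^+ 2) - (a * c + b * d) ^+ 2 =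
  (a * d - b * c) ^+ 2 by ring.
by rewrite real_exprn_even_ge0// rpredB// rpredM// ger0_real.
Qed.

Lemma hsum_normZ (l : R[i]) z : hsum_norm (l *: z) = `|l| * hsum_norm z.
Proof.
rewrite /hsum_norm /= !normrZ !exprMn -mulrDr rootCMl ?exprn_ge0//.
by rewrite sqrCK.
Qed.

Lemma hsum_norm_eq0 z : hsum_norm z = 0 -> z = 0.
Proof.
case: z => a b /eqP; rewrite sqrtC_eq0 paddr_eq0 ?exprn_ge0// !sqrf_eq0 !normr_eq0.
by case/andP => /eqP /= -> /eqP ->.
Qed.

HB.instance Definition _ := Lmodule_isNormed.Build R[i] H
  hsum_normD hsum_normZ hsum_norm_eq0.

Lemma hsum_normE (z : H) : `|z| = sqrtC (`|z.1| ^+ 2 + `|z.2| ^+ 2).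
Proof. by []. Qed.

Lemma hsum_norm_le1 (z : H) : `|z.1| <= `|z|.
Proof.
rewrite -(@ler_pXn2r _ 2)// ?nnegrE//.
by rewrite hsum_norm_sqr lerDl exprn_ge0.
Qed.

Lemma hsum_norm_le2 (z : H) : `|z.2| <= `|z|.
Proof.
rewrite -(@ler_pXn2r _ 2)// ?nnegrE//.
by rewrite hsum_norm_sqr lerDr exprn_ge0.
Qed.

Lemma hsum_norm_leD (z : H) : `|z| <= `|z.1| + `|z.2|.
Proof.
rewrite -(@ler_pXn2r _ 2)// ?nnegrE ?addr_ge0//.
rewrite hsum_norm_sqr sqrrD addrAC lerDl.
by rewrite mulrn_wge0// mulr_ge0.
Qed.

Lemma hsum_complete (F : set_system H) : ProperFilter F -> cauchy F -> cvg F.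
Proof.
move=> FF /cauchyP Fc.
pose p1 (z : H) : H0 := z.1; pose p2 (z : H) : H1 := z.2.
have /cauchy_cvg/cvg_ex[/= a Fa] : cauchy (p1 @ F).
  apply/cauchyP => e /Fc[z Fz]; exists (p1 z); apply: (@filterS _ F) Fz => w.
  rewrite -ball_normE => zw; rewrite /preimage/= -ball_normE.
  exact: le_lt_trans (hsum_norm_le1 (z - w)) zw.
have /cauchy_cvg/cvg_ex[/= b Fb] : cauchy (p2 @ F).
  apply/cauchyP => e /Fc[z Fz]; exists (p2 z); apply: (@filterS _ F) Fz => w.
  rewrite -ball_normE => zw; rewrite /preimage/= -ball_normE.
  exact: le_lt_trans (hsum_norm_le2 (z - w)) zw.
apply/cvg_ex; exists ((a, b) : H); apply/cvgrPdist_lt => e e0.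
have e20 : 0 < e / 2 by rewrite divr_gt0.
move/cvgrPdist_lt : Fa => /(_ _ e20) Fa; move/cvgrPdist_lt : Fb => /(_ _ e20) Fb.
near=> z; apply: le_lt_trans (hsum_norm_leD _) _; rewrite (splitr e) ltrD//.
- by near: z; exact: Fa.
- by near: z; exact: Fb.
Unshelve. all: by end_near. Qed.

HB.instance Definition _ := Uniform_isComplete.Build H hsum_complete.

Definition hsum_inner (z w : H) : R[i] := inner z.1 w.1 + inner z.2 w.2.

Lemma hsum_innerPl (a : R[i]) (x y z : H) :
  hsum_inner (a *: x + y) z = a * hsum_inner x z + hsum_inner y z.
Proof. by rewrite /hsum_inner /= !innerPl mulrDr addrACA. Qed.

Lemma hsum_inner_conj x y : hsum_inner y x = (hsum_inner x y)^*.
Proof. by rewrite /hsum_inner rmorphD/= -!inner_conj. Qed.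

Lemma hsum_inner_norm (x : H) : hsum_inner x x = `|x| ^+ 2.
Proof. by rewrite /hsum_inner !inner_norm hsum_norm_sqr. Qed.

HB.instance Definition _ := NormedModule_isHilbert.Build R H
  hsum_innerPl hsum_inner_conj hsum_inner_norm.

End DirectSum.

Section Operators.
Variable R : realType.
Implicit Types U W : hilbertType R.

Definition separable_space (T : topologicalType) :=
  exists2 D : set T, countable D & dense D.

Definition self_adjoint U (A : U -> U) :=
  forall x y, inner (A x) y = inner x (A y).

(* Here and for opabs and spectral_projection below, xget picks an object with
   the defining property. On the operators at hand (bounded operators; bounded
   self-adjoint operators for spectral_projection) there is exactly one such
   object, up to the values on non-Borel sets for spectral_projection. *)
Definition adjoint U W (T : U -> W) : W -> U :=
  xget (fun=> 0) [set S | forall x y, inner (T x) y = inner x (S y)].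

(* |T| = (T^* T)^(1/2), the nonnegative bounded square root; in R[i],
   0 <= z says that z is real and nonnegative. *)
Definition opabs U W (T : U -> W) : U -> U :=
  xget (fun=> 0) [set S | [/\ linear S, continuous S,
    (forall x, 0 <= inner (S x) x) &
    (forall x, S (S x) = adjoint T (T x))]].

Definition is_eigenvalue U (T : U -> U) (mu : R[i]) :=
  exists2 x, x != 0 & T x = mu *: x.

Definition spectrum U (T : U -> U) : set R[i] :=
  [set mu | ~ exists S : {linear U -> U}, [/\ continuous S,
    (forall x, S (T x - mu *: x) = x) &
    (forall x, T (S x) - mu *: S x = x)]].

(* The spectrum of a self-adjoint operator is real, so that the real parts
   of its elements are its elements. The bounds are -oo and +oo when the
   spectrum is empty, that is, when U is the zero space. *)
Definition sup_spec U (T : U -> U) : \bar R :=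
  ereal_sup [set (complex.Re mu)%:E | mu in spectrum T].

Definition inf_spec U (T : U -> U) : \bar R :=
  ereal_inf [set (complex.Re mu)%:E | mu in spectrum T].

Definition orthogonal_projection U (P : U -> U) :=
  [/\ linear P, (forall x, P (P x) = P x) & self_adjoint P].

(* E is the projection-valued Borel measure with bounded support such that
   A = \int t dE(t). Since E(D) and A are self-adjoint, the numbers
   <E(D) x, x> and <A x, x> are real, and by polarization they determine the
   operators. Countable additivity of E is that of D |-> <E(D) x, x>, for
   all x. *)
Record is_spectral_measure U (A : U -> U) (E : set R -> U -> U) : Prop := {
  spectral_measure_proj : forall D, measurable D ->
    orthogonal_projection (E D);
  spectral_measure_setT : forall x, E setT x = x;
  spectral_measure_setI : forall D1 D2, measurable D1 -> measurable D2 ->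
    forall x, E (D1 `&` D2) x = E D1 (E D2 x);
  spectral_measure_bounded : exists M : R, forall x, E `[- M, M]%classic x = x;
  spectral_measure_integral : forall x,
    exists2 nu : {measure set (measurableTypeR R) -> \bar R},
      (forall D : set R, measurable D ->
         nu D = (complex.Re (inner (E D x) x))%:E) &
      (\int[nu]_t t%:E)%E = (complex.Re (inner (A x) x))%:E
}.

Definition spectral_projection U (A : U -> U) : set R -> U -> U :=
  xget (fun _ _ => 0) (is_spectral_measure A).

Definition spectral_subspace U (A : U -> U) (L : set U) :=
  exists2 D : set R, measurable D & L = range (spectral_projection A D).

Variables H0 H1 : hilbertType R.
Implicit Types X : H0 -> H1.

Definition block_operator (A0 : H0 -> H0) (A1 : H1 -> H1) (V : H1 -> H0)
    : hsum H0 H1 -> hsum H0 H1 :=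
  fun z => (A0 z.1 + V z.2, adjoint V z.1 + A1 z.2).

Definition graph0 X : set (hsum H0 H1) := [set (x, X x) | x in setT].

Definition graph1 (Y : H1 -> H0) : set (hsum H0 H1) := [set (Y y, y) | y in setT].

Definition contractive_solution (A0 : H0 -> H0) (A1 : H1 -> H1) (V : H1 -> H0)
    X :=
  (forall x, `|X x| <= `|x|) /\
  (forall x, A1 (X x) - X (A0 x) - X (V (X x)) + adjoint V x = 0).

Definition unique_contractive_solution (A0 : H0 -> H0) (A1 : H1 -> H1)
    (V : H1 -> H0) X :=
  contractive_solution A0 A1 V X /\
  forall Y : {linear H0 -> H1}, contractive_solution A0 A1 V Y -> Y =1 X.

Definition strict_contraction X := forall x, x != 0 -> `|X x| < `|x|.

End Operators.

(* Main.v *)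
Require Import Defs.
From HB Require Import structures.
From mathcomp Require Import all_boot all_order all_algebra.
From mathcomp Require Import complex ring lra.
From mathcomp Require Import all_classical all_reals all_analysis measurable_realfun.

(** Write B for the block operator, G for the graph of X, and J for the
symmetry J(x, y) = (x, -y). The Riccati equation says that G is invariant
under B (riccati_graph); B being self-adjoint, G reduces B. Since
A0 <= lambda <= A1, the form Re <J (B - lambda) z, z> is nonpositive, V
contributing nothing to its real part (dissipative). If X is a strict
contraction, J is positive on G and negative on the orthogonal complement of
G, which is the graph of -X^*. The inequality J (B - lambda) + (B - lambda) J
<= 0 is of Lyapunov type: it forces B <= lambda on G and B >= lambda on the
complement (lyapunov, definite_side, graph_below, graph_above). Hence G can
differ from the spectral subspaces of B for ]-oo, lambda[ and ]-oo, lambda]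
only inside Ker (B - lambda). This kernel is K0 (+) K1 with
K0 = Ker (A0 - lambda) :&: Ker V^* and K1 = Ker (A1 - lambda) :&: Ker V
(ker_block). If K1 = 0 then G is the spectral subspace of ]-oo, lambda]
(graph_spectral_le), and if K0 = 0 then it is that of ]-oo, lambda[
(graph_spectral_lt).

Suppose that X is the unique contractive solution. On N = Ker (1 - X^* X) the
sign of X may be changed, which gives another contractive solution; so N = 0
and X is a strict contraction (unique_not_isometric). Let P0 and P1 be the
projections onto K0 and K1. Both X (1 - P0) and (1 - P1) X are contractive
solutions, so X vanishes on K0 and its range is orthogonal to K1; then a
rank one operator from K0 to K1 can be added to X, and therefore K0 = 0 or
K1 = 0 (unique_dichotomy).

Conversely, let G be a spectral subspace and X a strict contraction, and let
Y be a contractive solution. The graph of Y reduces B, hence also the spectral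
projection onto G. The component orthogonal to G of a vector (x, y) in the
graph of Y is in that graph, where |y| <= |x|, and in the graph of -X^*, where
|x| < |y| unless the vector is 0. So the graph of Y is contained in G, and
Y = X (spectral_graph_unique).

All this rests on the spectral theorem for bounded self-adjoint operators and
on the uniqueness of the spectral measure, which are proved first. The
absolute value of an operator is the limit of an iteration (sqrt_limit). With
C = B - a, the projections E(a) onto Ker (|C| + C) form the spectral family of
B (spectral_split). The Stieltjes measures of a |-> <E(a) x, x> define the
projections of all Borel sets by a Dynkin argument (projection_of_set), and
their first moment is computed by repeated bisection (integral_bisection). For
an arbitrary spectral measure F of B, the projection F(]-oo, a]) is E(a); so
all the F(D) commute with the projections that commute with B
(spectral_commute).

The Hilbert space arguments use the real inner product Re <x, y>: quadratic
forms of self-adjoint operators are real, and a complex linear operator is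
determined by its real parts. *)

Set Implicit Arguments.
Unset Strict Implicit.
Unset Printing Implicit Defensive.

Import Order.TTheory GRing.Theory Num.Theory.
Import numFieldNormedType.Exports.

Local Open Scope classical_set_scope.
Local Open Scope ring_scope.

(** * The real inner product *)

Section RealInner.
Local Open Scope complex_scope.
Variable R : realType.
Implicit Types U W : hilbertType R.

Definition rdot U (x y : U) : R := complex.Re (inner x y).

(** The norm takes its values in [R[i]]; this is the same number as a real one. *)
Definition nrm U (x : U) : R := complex.Re `|x|.

(** Scaling by a real number, kept apart from scaling by a complex one so that it
comes out of [rdot] on either side without conjugation. *)
Definition rscale U (r : R) (x : U) : U := r%:C *: x.

Lemma innerDl U (x y z : U) : inner (x + y) z = inner x z + inner y z.
Proof. by rewrite -[x]scale1r innerPl mul1r scale1r. Qed.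

Lemma inner0l U (z : U) : inner 0 z = 0.
Proof. by apply: (addrI (inner 0 z)); rewrite -innerDl !addr0. Qed.

Lemma innerZl U a (x z : U) : inner (a *: x) z = a * inner x z.
Proof. by rewrite -[a *: x]addr0 innerPl inner0l addr0. Qed.

Lemma innerZr U a (x z : U) : inner z (a *: x) = conjc a * inner z x.
Proof. by rewrite inner_conj innerZl rmorphM/= -!inner_conj. Qed.

Lemma ReD (a b : R[i]) : complex.Re (a + b) = complex.Re a + complex.Re b.
Proof. by case: a b => [? ?] []. Qed.

Lemma ReZ (r : R) (b : R[i]) : complex.Re (r%:C * b) = r * complex.Re b.
Proof. by case: b => x y /=; rewrite mul0r subr0. Qed.

Lemma ReJ (b : R[i]) : complex.Re (b^*) = complex.Re b.
Proof. by case: b. Qed.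

Lemma rdotC U (x y : U) : rdot x y = rdot y x.
Proof. by rewrite /rdot inner_conj ReJ. Qed.

Lemma rdotDl U (x y z : U) : rdot (x + y) z = rdot x z + rdot y z.
Proof. by rewrite /rdot innerDl ReD. Qed.

Lemma rdotDr U (x y z : U) : rdot z (x + y) = rdot z x + rdot z y.
Proof. by rewrite ![rdot z _]rdotC rdotDl. Qed.

Lemma rdotZl U r (x z : U) : rdot (rscale r x) z = r * rdot x z.
Proof. by rewrite /rdot innerZl ReZ. Qed.

Lemma rdotZr U r (x z : U) : rdot z (rscale r x) = r * rdot z x.
Proof. by rewrite ![rdot z _]rdotC rdotZl. Qed.

Lemma rscaleN1 U (x : U) : rscale (-1) x = - x.
Proof. by rewrite /rscale rmorphN1 scaleN1r. Qed.

Lemma rscale1 U (x : U) : rscale 1 x = x.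
Proof. by rewrite /rscale scale1r. Qed.

Lemma rdotNl U (x z : U) : rdot (- x) z = - rdot x z.
Proof. by rewrite -rscaleN1 rdotZl mulN1r. Qed.

Lemma rdotNr U (x z : U) : rdot z (- x) = - rdot z x.
Proof. by rewrite ![rdot z _]rdotC rdotNl. Qed.

Lemma rdotBl U (x y z : U) : rdot (x - y) z = rdot x z - rdot y z.
Proof. by rewrite rdotDl rdotNl. Qed.

Lemma rdotBr U (x y z : U) : rdot z (x - y) = rdot z x - rdot z y.
Proof. by rewrite rdotDr rdotNr. Qed.

Lemma rdot0l U (z : U) : rdot 0 z = 0.
Proof. by rewrite /rdot inner0l. Qed.

Lemma rdot0r U (z : U) : rdot z 0 = 0.
Proof. by rewrite rdotC rdot0l. Qed.

Definition rdotE := (rdotDl, rdotDr, rdotNl, rdotNr, rdotZl, rdotZr, rdot0l, rdot0r).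

Lemma normE U (x : U) : `|x| = (nrm x)%:C.
Proof. by rewrite /nrm RRe_real// ger0_real. Qed.

Lemma nrm_ge0 U (x : U) : 0 <= nrm x.
Proof. by rewrite -ler0c -normE. Qed.

Lemma inner_self U (x : U) : inner x x = (nrm x ^+ 2)%:C.
Proof. by rewrite inner_norm normE rmorphXn. Qed.

Lemma rdot_self U (x : U) : rdot x x = nrm x ^+ 2.
Proof. by rewrite /rdot inner_self. Qed.

Lemma rdot_ge0 U (x : U) : 0 <= rdot x x.
Proof. by rewrite rdot_self sqr_ge0. Qed.

Lemma nrm_eq0 U (x : U) : nrm x = 0 -> x = 0.
Proof. by move=> h; apply/normr0_eq0; rewrite normE h. Qed.

Lemma nrm0 U : nrm (0 : U) = 0.
Proof. by rewrite /nrm normr0. Qed.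

Lemma rdot_eq0 U (x : U) : rdot x x = 0 -> x = 0.
Proof. by rewrite rdot_self => /eqP; rewrite sqrf_eq0 => /eqP/nrm_eq0. Qed.

Lemma rdot_gt0 U (x : U) : x != 0 -> 0 < rdot x x.
Proof.
by move=> x0; rewrite lt_neqAle rdot_ge0 andbT eq_sym; apply: contra x0 => /eqP/rdot_eq0->.
Qed.

Lemma nrmD U (x y : U) : nrm (x + y) <= nrm x + nrm y.
Proof. by rewrite -lecR rmorphD/= -!normE ler_normD. Qed.

Lemma nrmN U (x : U) : nrm (- x) = nrm x.
Proof. by rewrite /nrm normrN. Qed.

Lemma nrmB U (x y : U) : nrm (x - y) <= nrm x + nrm y.
Proof. by rewrite -(nrmN y) nrmD. Qed.

Lemma nrmZ U r (x : U) : nrm (rscale r x) = `|r| * nrm x.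
Proof.
apply: complexI; rewrite -normE normrZ normE normc_def/= expr0n addr0 sqrtr_sqr.
by rewrite rmorphM.
Qed.

Lemma rdot_eq U (x y : U) : (forall z, rdot x z = rdot y z) -> x = y.
Proof.
move=> h; apply/eqP; rewrite -subr_eq0; apply/eqP/rdot_eq0.
by rewrite rdotBl h subrr.
Qed.

(** The squared norm of x <x, y> / |x|^2 - y is nonnegative. *)
Lemma cauchy_schwarz U (x y : U) : rdot x y <= nrm x * nrm y.
Proof.
have := nrm_ge0 x; have := nrm_ge0 y.
have [->|x0] := eqVneq x 0; first by rewrite rdot0l nrm0 mul0r.
have xp := rdot_gt0 x0; rewrite rdot_self in xp.
have m0 : nrm x != 0 by apply: contra x0 => /eqP/nrm_eq0->.
move=> ny nx.
have := rdot_ge0 (rscale (rdot x y / nrm x ^+ 2) x - y).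
rewrite !(rdotE) (rdotC y x) !rdot_self.
set d := rdot x y.
rewrite (_ : _ + _ = nrm y ^+ 2 - d ^+ 2 / nrm x ^+ 2); last by field.
rewrite subr_ge0 ler_pdivrMr// -exprMn => h.
have [d0|/ltW d0] := leP d 0; first by apply: le_trans d0 _; rewrite mulr_ge0.
by move: h; rewrite ler_pXn2r ?nnegrE ?mulr_ge0// mulrC.
Qed.

Lemma cauchy_schwarz_norm U (x y : U) : `|rdot x y| <= nrm x * nrm y.
Proof. by rewrite ler_norml cauchy_schwarz andbT lerNl -rdotNl -(nrmN x) cauchy_schwarz. Qed.

End RealInner.

(** * Bounded operators and convergence in norm *)

Section Operators.
Local Open Scope complex_scope.
Variable R : realType.
Implicit Types U W : hilbertType R.

(** The complex inner product is recovered from the real one: its imaginary part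
is the real part at [i y]. *)
Lemma innerE U (x y : U) : inner x y = rdot x y +i* rdot x ('i *: y).
Proof. by rewrite /rdot innerZr /=; case: (inner x y) => a b /=; congr (_ +i* _); ring. Qed.

Lemma rdot_iN U (x y : U) : rdot ('i *: x) y = - rdot x ('i *: y).
Proof. by rewrite /rdot innerZl innerZr; case: (inner x y) => a b /=; ring. Qed.

(** Bounded linear operators, as a predicate on functions: the operators of the
theorem are functions, and adjoints, limits and projections arise as such. *)
Definition blin U W (f : U -> W) :=
  linear f /\ exists2 C : R, 0 <= C & forall x, nrm (f x) <= C * nrm x.

Lemma linD U W (f : U -> W) : linear f -> forall x y, f (x + y) = f x + f y.
Proof. by move=> lf x y; rewrite -[x in LHS]scale1r lf scale1r. Qed.

Lemma lin0 U W (f : U -> W) : linear f -> f 0 = 0.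
Proof. by move=> lf; apply: (addrI (f 0)); rewrite -linD// !addr0. Qed.

Lemma linZ U W (f : U -> W) : linear f -> forall a x, f (a *: x) = a *: f x.
Proof. by move=> lf a x; rewrite -[a *: x]addr0 lf lin0// addr0. Qed.

Lemma blinD U W (f : U -> W) : blin f -> forall x y, f (x + y) = f x + f y.
Proof. by case=> /linD. Qed.

Lemma blin0 U W (f : U -> W) : blin f -> f 0 = 0.
Proof. by case=> /lin0. Qed.

Lemma blinZ U W (f : U -> W) : blin f -> forall a x, f (a *: x) = a *: f x.
Proof. by case=> /linZ. Qed.

Lemma blinN U W (f : U -> W) : blin f -> forall x, f (- x) = - f x.
Proof. by move=> bf x; rewrite -scaleN1r blinZ// scaleN1r. Qed.

Lemma blinB U W (f : U -> W) : blin f -> forall x y, f (x - y) = f x - f y.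
Proof. by move=> bf x y; rewrite blinD// blinN. Qed.

Lemma blinR U W (f : U -> W) : blin f -> forall r x, f (rscale r x) = rscale r (f x).
Proof. by move=> bf r x; exact: blinZ. Qed.

Lemma blin_id U : blin (fun x : U => x).
Proof. by split => //; exists 1 => // x; rewrite mul1r. Qed.

Lemma blin_comp U W (V : hilbertType R) (f : W -> V) (g : U -> W) :
  blin f -> blin g -> blin (fun x => f (g x)).
Proof.
move=> [lf [C C0 hC]] [lg [D D0 hD]]; split=> [a x y|]; first by rewrite lg lf.
by exists (C * D) => [|x]; rewrite ?mulr_ge0// (le_trans (hC _))// -mulrA ler_wpM2l.
Qed.

Lemma blin_add U W (f g : U -> W) : blin f -> blin g -> blin (fun x => f x + g x).
Proof.
move=> [lf [C C0 hC]] [lg [D D0 hD]]; split=> [a x y|].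
  by rewrite lf lg scalerDr addrACA.
by exists (C + D) => [|x]; rewrite ?addr_ge0// (le_trans (nrmD _ _))// mulrDl lerD.
Qed.

Lemma blin_scale U W (f : U -> W) r : blin f -> blin (fun x => rscale r (f x)).
Proof.
move=> [lf [C C0 hC]]; split=> [a x y|].
  by rewrite lf /rscale scalerDr !scalerA mulrC.
by exists (`|r| * C) => [|x]; rewrite ?mulr_ge0// nrmZ -mulrA ler_wpM2l.
Qed.

Lemma blin_opp U W (f : U -> W) : blin f -> blin (fun x => - f x).
Proof.
move=> /(blin_scale (-1)); congr blin; apply/funext => x; exact: rscaleN1.
Qed.

Lemma blin_sub U W (f g : U -> W) : blin f -> blin g -> blin (fun x => f x - g x).
Proof. by move=> bf bg; apply: blin_add => //; apply: blin_opp. Qed.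

Lemma continuous_blin U W (f : U -> W) : linear f -> continuous f -> blin f.
Proof.
move=> lf cf; split=> //.
pose g : {linear U -> W} := HB.pack f (GRing.isLinear.Build _ _ _ _ f lf).
have /linear_boundedP : bounded_near g (nbhs (0 : U)).
  by apply/linear_bounded_continuous.
case=> M [Mr /= hM].
pose m : R[i] := `|M| + 1.
have mM : M < m by rewrite (le_lt_trans (real_ler_norm Mr))// ltrDl ltr01.
have m0 : 0 <= m by rewrite addr_ge0.
exists (complex.Re m) => [|x]; first by move: m0; rewrite lecE => /andP[].
have := hM _ mM x; rewrite /= !normE -(RRe_real (ger0_real m0)) -rmorphM/=.
by rewrite lecR.
Qed.

Lemma blin_continuous U W (f : U -> W) : blin f -> continuous f.
Proof.
case=> lf [C C0 hC].
pose g : {linear U -> W} := HB.pack f (GRing.isLinear.Build _ _ _ _ f lf).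
suff : continuous g by [].
apply/linear_bounded_continuous/linear_boundedP.
exists C%:C; split=> [|M CM x /=]; first by rewrite ger0_real// ler0c.
rewrite !normE (le_trans _ (ler_wpM2r _ (ltW CM))) ?ler0c ?nrm_ge0//.
by rewrite -rmorphM/= lecR hC.
Qed.

(** Convergence in norm, stated in [R] where the order and the limits of real
sequences are available. *)
Definition sconv U (u : nat -> U) (l : U) :=
  (fun n => nrm (u n - l)) @ \oo --> (0 : R).

(** The Cauchy criterion in the shape in which it occurs below: the squared
distances are controlled by a null sequence indexed by the smaller rank. *)
Lemma cauchy_sconv U (u : nat -> U) (e : nat -> R) : e @ \oo --> (0 : R) ->
  (forall n m, (n <= m)%N -> rdot (u m - u n) (u m - u n) <= e n) ->
  exists l, sconv u l.
Proof.
move=> e0 ue.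
have small (d : R[i]) : 0 < d -> 0 < complex.Re d /\ d = (complex.Re d)%:C.
  by move=> d0; move: (d0); rewrite ltcE/= => /andP[_ ->]; rewrite RRe_real// gtr0_real.
have /cauchy_cvg/cvg_ex[l ul] : cauchy (u @ \oo).
  apply/cauchyP => d d0; have [r0 dE] := small _ d0.
  set r := complex.Re d in r0 dE.
  have r20 : 0 < r ^+ 2 by rewrite exprn_gt0.
  move/cvgrPdist_lt : e0 => /(_ _ r20)[N _ hN]; exists (u N).
  exists N => // n /= Nn; rewrite -ball_normE/= normE dE ltcR.
  have := ue _ _ Nn; rewrite rdot_self => h.
  rewrite -(@ltr_pXn2r _ 2)// ?nnegrE ?nrm_ge0 ?(ltW r0)//.
  rewrite -opprB nrmN (le_lt_trans h)//.
  have := hN N (leqnn N); rewrite sub0r normrN; apply: le_lt_trans.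
  exact: ler_norm.
exists l; apply/cvgrPdist_lt => d d0.
have : 0 < d%:C by rewrite ltcR.
move/cvgrPdist_lt : ul => /[apply]; apply: filterS => n.
by rewrite normE ltcR sub0r normrN ger0_norm ?nrm_ge0// -opprB nrmN.
Qed.

Lemma squeeze0 (a b : nat -> R) : (forall n, 0 <= a n <= b n) ->
  b @ \oo --> (0 : R) -> a @ \oo --> (0 : R).
Proof.
move=> ab b0; apply: (squeeze_cvgr _ (cvg_cst (0 : R)) b0).
by near=> n; exact: ab.
Unshelve. all: by end_near. Qed.

Lemma sconv_rdot U (u : nat -> U) l y : sconv u l ->
  (fun n => rdot (u n) y) @ \oo --> rdot l y.
Proof.
move=> ul; apply/subr_cvg0/norm_cvg0P => /=.
apply: (squeeze0 (b := fun n => nrm (u n - l) * nrm y)) => [n|].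
  by rewrite normr_ge0/= -rdotBl cauchy_schwarz_norm.
by rewrite -[X in _ --> X](mul0r (nrm y)); apply: cvgM => //; exact: cvg_cst.
Qed.

Lemma sconv_unique U (u : nat -> U) l l' : sconv u l -> sconv u l' -> l = l'.
Proof.
move=> ul ul'; apply: rdot_eq => z.
exact: (cvg_unique _ (sconv_rdot (y := z) ul) (sconv_rdot ul')).
Qed.

Lemma sconv_blin U W (f : U -> W) (u : nat -> U) l : blin f -> sconv u l ->
  sconv (fun n => f (u n)) (f l).
Proof.
move=> bf ul; case: (bf) => _ [C C0 hC].
apply: (squeeze0 (b := fun n => C * nrm (u n - l))) => [n|].
  by rewrite nrm_ge0/= -blinB// hC.
by rewrite -[X in _ --> X](mulr0 C); apply: cvgM => //; exact: cvg_cst.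
Qed.

Lemma sconvD U (u v : nat -> U) l k : sconv u l -> sconv v k ->
  sconv (fun n => u n + v n) (l + k).
Proof.
move=> ul vk.
apply: (squeeze0 (b := fun n => nrm (u n - l) + nrm (v n - k))) => [n|].
  by rewrite nrm_ge0/= opprD addrACA nrmD.
by rewrite -[X in _ --> X](addr0 0); apply: cvgD.
Qed.

Lemma sconv_cst U (l : U) : sconv (fun=> l) l.
Proof. by rewrite /sconv subrr nrm0; exact: cvg_cst. Qed.

Lemma sconv_nrm_le U (u : nat -> U) l (M : R) : sconv u l ->
  (forall n, nrm (u n) <= M) -> nrm l <= M.
Proof.
move=> ul uM; apply/ler_addgt0Pr => e e0.
move/cvgrPdist_lt : ul => /(_ _ e0)[N _ /(_ N (leqnn N))].
rewrite /= sub0r normrN ger0_norm ?nrm_ge0// => h.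
have -> : l = u N - (u N - l) by rewrite opprB addrC subrK.
by rewrite (le_trans (nrmB _ _))// lerD// ltW.
Qed.

End Operators.

(** * Orthogonal projections and adjoints *)

Section Projections.
Local Open Scope complex_scope.
Variable R : realType.
Implicit Types U W : hilbertType R.

(** The choice t = a / (s + 1) makes the quadratic negative unless a = 0. *)
Lemma linear_term_eq0 (s a : R) : 0 <= s ->
  (forall t, 0 <= t ^+ 2 * s - 2 * t * a) -> a = 0.
Proof.
move=> s0 /(_ (a / (s + 1))).
have s1 : s + 1 != 0 by rewrite gt_eqF// ltr_wpDl.
have -> : (a / (s + 1)) ^+ 2 * s - 2 * (a / (s + 1)) * a =
  - (a / (s + 1)) ^+ 2 * (s + 2) by field.
rewrite mulNr oppr_ge0 pmulr_lle0 ?ltr_wpDl// => h.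
have /eqP : (a / (s + 1)) ^+ 2 = 0 by apply/le_anti; rewrite h sqr_ge0.
by rewrite sqrf_eq0 mulf_eq0 invr_eq0 (negPf s1) orbF => /eqP.
Qed.

(** Closed real subspaces. Kernels of real linear functionals are only real
subspaces, and the representation of such functionals needs projections onto
them. *)
Record rsubspace U (K : set U) : Prop := {
  rsubspace0 : K 0;
  rsubspaceD : forall x y, K x -> K y -> K (x + y);
  rsubspaceR : forall r x, K x -> K (rscale r x);
  rsubspace_lim : forall u l, (forall n, K (u n)) -> sconv u l -> K l }.

(** A minimizing sequence of the distance to K is Cauchy by the parallelogram
identity; the variation of the distance along K at its limit vanishes. *)
Lemma nearest_point U (K : set U) x : rsubspace K ->
  exists2 k, K k & forall k', K k' -> rdot (x - k) k' = 0.
Proof.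
move=> [K0 KD KR Kl].
pose S := [set rdot (x - k) (x - k) | k in K].
have hS : has_inf S.
  split; first by exists (rdot (x - 0) (x - 0)), 0.
  by exists 0 => _ [k _ <-]; exact: rdot_ge0.
set d := inf S.
have dS k : K k -> d <= rdot (x - k) (x - k).
  by move=> Kk; apply: ge_inf; [case: hS|exists k].
have /choice[u hu] (n : nat) : exists k, K k /\ rdot (x - k) (x - k) < d + n.+1%:R^-1.
  have [_ [k Kk <-] h] := inf_adherent (ltac:(by rewrite invr_gt0) : 0 < n.+1%:R^-1) hS.
  by exists k.
have hcvg : (fun n : nat => 4 * n.+1%:R^-1) @ \oo --> (0 : R).
  rewrite -[X in _ --> X](mulr0 4); apply: cvgM; first exact: cvg_cst.
  exact: cvg_harmonic.
have [|k uk] := cauchy_sconv (u := u) hcvg.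
  move=> n m nm.
  have [[Kn hn] [Km hm]] := (hu n, hu m).
  (* The midpoint of u n and u m is in K: this is the parallelogram identity. *)
  have := dS _ (rsubspaceR (Build_rsubspace K0 KD KR Kl) 2^-1 (KD _ _ Kn Km)).
  have : (m.+1%:R^-1 : R) <= n.+1%:R^-1 by rewrite lef_pV2 ?posrE// ler_nat.
  move: hn hm; rewrite !rdotE !(rdotC x) (rdotC (u m) (u n)).
  set q := n.+1%:R^-1; set p := m.+1%:R^-1; move: q p => q p; lra.
exists k => [|k' Kk']; first by apply: Kl uk => n; have [] := hu n.
apply: (linear_term_eq0 (rdot_ge0 k')) => t.
have cv : (fun n => t ^+ 2 * rdot k' k' + 2 * t * (rdot (u n) k' - rdot x k') + n.+1%:R^-1)
   @ \oo --> t ^+ 2 * rdot k' k' + 2 * t * (rdot k k' - rdot x k') + 0.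
  apply: cvgD; last exact: cvg_harmonic.
  apply: cvgD; first exact: cvg_cst.
  apply: cvgM; first exact: cvg_cst.
  apply: cvgD; [exact: sconv_rdot|exact: cvg_cst].
have -> : t ^+ 2 * rdot k' k' - 2 * t * rdot (x - k) k' =
   t ^+ 2 * rdot k' k' + 2 * t * (rdot k k' - rdot x k') + 0.
  by rewrite rdotBl; ring.
rewrite -(cvg_lim _ cv)//; apply: limr_ge; first by apply/cvg_ex; eexists; exact: cv.
near=> n.
have [Kn hn] := hu n.
have := dS _ (KD _ _ Kn (KR t _ Kk')).
move: hn; rewrite !rdotE !(rdotC x) (rdotC k' (u n)); set q := n.+1%:R^-1; move: q => q.
move=> h1 h2; rewrite -subr_ge0 in h2; rewrite -subr_gt0 in h1.
have := addr_ge0 h2 (ltW h1); congr (0 <= _); ring.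
Unshelve. all: by end_near. Qed.

Lemma rdotZc U a (x y : U) : rdot (a *: x) y = rdot x (conjc a *: y).
Proof. by rewrite /rdot innerZl innerZr conjcK. Qed.

Lemma scaleC U a (x : U) :
  a *: x = rscale (complex.Re a) x + rscale (complex.Im a) ('i *: x).
Proof. by rewrite /rscale scalerA -scalerDl {1}[a]complexE mulrC. Qed.

Record csubspace U (K : set U) : Prop := {
  csubspace_r : rsubspace K;
  csubspace_i : forall x, K x -> K ('i *: x) }.

Lemma csubspaceZ U (K : set U) a x : csubspace K -> K x -> K (a *: x).
Proof.
move=> [[K0 KD KR Kl] Ki] Kx; rewrite scaleC; apply: KD; apply: KR => //.
exact: Ki.
Qed.

(** Self-adjointness for the real inner product. For a complex linear operator
it is equivalent to [self_adjoint], by innerE. *)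
Definition rsa U (T : U -> U) := forall x y, rdot (T x) y = rdot x (T y).

Lemma self_adjoint_rsa U (T : U -> U) : self_adjoint T -> rsa T.
Proof. by move=> h x y; rewrite /rdot h. Qed.

Lemma rsa_self_adjoint U (T : U -> U) : linear T -> rsa T -> self_adjoint T.
Proof. by move=> lT h x y; rewrite !innerE !h linZ. Qed.

Record oproj U (P : U -> U) : Prop := {
  oproj_blin : blin P;
  oproj_idem : forall x, P (P x) = P x;
  oproj_rsa : rsa P }.

Lemma oproj_pythagoras U (P : U -> U) x : oproj P ->
  rdot x x = rdot (P x) (P x) + rdot (x - P x) (x - P x).
Proof.
move=> hP; have h : rdot (P x) x = rdot (P x) (P x).
  by rewrite (oproj_rsa hP x) -{1}(oproj_idem hP x) -(oproj_rsa hP).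
by rewrite !rdotE (rdotC x (P x)) h; ring.
Qed.

Lemma oproj_quad U (P : U -> U) x : oproj P -> rdot (P x) x = rdot (P x) (P x).
Proof. by move=> hP; rewrite [RHS](oproj_rsa hP) (oproj_idem hP) rdotC. Qed.

Lemma ler_nrm U W (x : U) (y : W) : rdot x x <= rdot y y -> nrm x <= nrm y.
Proof. by rewrite !rdot_self ler_pXn2r ?nnegrE ?nrm_ge0. Qed.

Lemma ler_rdot U W (x : U) (y : W) : nrm x <= nrm y -> rdot x x <= rdot y y.
Proof. by rewrite !rdot_self ler_pXn2r ?nnegrE ?nrm_ge0. Qed.

Lemma oproj_le U (P : U -> U) x : oproj P -> nrm (P x) <= nrm x.
Proof. by move=> hP; apply: ler_nrm; rewrite (oproj_pythagoras x hP) lerDl rdot_ge0. Qed.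

Lemma oproj_orth U (P : U -> U) x y : oproj P -> rdot (P x) (y - P y) = 0.
Proof. by move=> hP; rewrite rdotBr !(oproj_rsa hP) (oproj_idem hP) subrr. Qed.

Lemma oproj_compl U (P : U -> U) : oproj P -> oproj (fun x => x - P x).
Proof.
move=> hP; have bP := oproj_blin hP; split.
- by apply: blin_sub => //; exact: blin_id.
- by move=> x; rewrite blinB// (oproj_idem hP) subrr subr0.
- by move=> x y; rewrite rdotBl rdotBr (oproj_rsa hP).
Qed.

Lemma oprojP U (P : U -> U) : oproj P -> orthogonal_projection P.
Proof.
move=> [bP iP sP]; split=> //; first by case: bP.
by apply: rsa_self_adjoint => //; case: bP.
Qed.

Lemma orthogonal_projectionP U (P : U -> U) : orthogonal_projection P -> oproj P.
Proof.
move=> [lP iP /self_adjoint_rsa sP]; split=> //; split=> //.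
exists 1 => // x; rewrite mul1r; apply: ler_nrm.
rewrite -subr_ge0.
have -> : rdot x x - rdot (P x) (P x) = rdot (x - P x) (x - P x).
  have h : rdot (P x) x = rdot (P x) (P x) by rewrite [RHS]sP iP rdotC.
  by rewrite !rdotE (rdotC x (P x)) h; ring.
exact: rdot_ge0.
Qed.

(** Nearest points in K are unique, so the map to the nearest point commutes with
the operations under which K is closed. *)
Lemma projection_theorem U (K : set U) : csubspace K ->
  exists P, [/\ oproj P, (forall x, K (P x)) & (forall x, K x -> P x = x)].
Proof.
move=> cK; have [rK Ki] := cK; have [K0 KD KR Kl] := rK.
have /choice[P hP] x : exists k, K k /\ forall k', K k' -> rdot (x - k) k' = 0.
  by have [k] := nearest_point x rK; exists k.
have PE x k : K k -> (forall k', K k' -> rdot (x - k) k' = 0) -> P x = k.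
  move=> Kk hk; have [KP h] := hP x.
  apply/eqP; rewrite -subr_eq0; apply/eqP/rdot_eq0.
  have Kd : K (P x - k) by apply: KD => //; rewrite -rscaleN1; exact: KR.
  have {1}-> : P x - k = (x - k) - (x - P x) by rewrite opprB [RHS]addrC addrA subrK.
  rewrite rdotBl.
  by rewrite hk// h// subrr.
have Pid x : K x -> P x = x.
  by move=> Kx; apply: PE => // k' _; rewrite subrr rdot0l.
have lP : linear P.
  move=> a x y; apply: PE.
    by apply: KD; [apply: csubspaceZ|]; have [] := hP y => //; have [] := hP x.
  move=> k' Kk'; rewrite opprD addrACA -scalerBr rdotDl rdotZc.
  have [_ ->//] := hP x; last exact: csubspaceZ.
  by have [_ ->//] := hP y; rewrite addr0.
have sP : rsa P.
  move=> x y; have [[Kx hx] [Ky hy]] := (hP x, hP y).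
  have := hx _ Ky; have := hy _ Kx; rewrite !rdotBl (rdotC y) (rdotC (P y)).
  by move/eqP; rewrite subr_eq0 => /eqP-> /eqP; rewrite subr_eq0 => /eqP->.
exists P; split=> //; last by move=> x; have [] := hP x.
apply: orthogonal_projectionP; split=> //; last exact: rsa_self_adjoint.
by move=> x; apply: Pid; have [] := hP x.
Qed.

(** A vector orthogonal to the kernel, if there is one outside, represents the
functional up to a factor. *)
Lemma riesz_representation U (f : U -> R) (C : R) :
  (forall x y, f (x + y) = f x + f y) -> (forall r x, f (rscale r x) = r * f x) ->
  (forall x, `|f x| <= C * nrm x) -> exists y, forall x, f x = rdot x y.
Proof.
move=> fD fR fC.
have f0 : f 0 = 0 by have := fR 0 0; rewrite mul0r /rscale scaler0.
have fB x y : f (x - y) = f x - f y by rewrite fD -rscaleN1 fR mulN1r.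
have rK : rsubspace [set x | f x = 0].
  split => //= [x y fx fy|r x fx|u l fu ul].
  - by rewrite fD fx fy addr0.
  - by rewrite fR fx mulr0.
  - have : (fun n => f (u n - l)) @ \oo --> (0 : R).
      apply/norm_cvg0P; apply: (squeeze0 (b := fun n => C * nrm (u n - l))) => [n|].
        by rewrite normr_ge0/= fC.
      by rewrite -[X in _ --> X](mulr0 C); apply: cvgM => //; exact: cvg_cst.
    have -> : (fun n => f (u n - l)) = fun=> - f l.
      by apply/funext => n; rewrite fB fu sub0r.
    move=> h; have e : (0 : R) = - f l by exact: (cvg_unique _ h (cvg_cst (- f l))).
    by apply/eqP; rewrite -oppr_eq0 -e.
have [h|/existsNP[x0 /eqP fx0]] := pselect (forall x, f x = 0).
  by exists 0 => x; rewrite rdot0r.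
have [k fk orth] := nearest_point x0 rK.
set w := x0 - k in orth.
have fw : f w = f x0 by rewrite fB fk subr0.
have w0 : rdot w w != 0.
  apply: contra fx0 => /eqP/rdot_eq0 w0; rewrite -fw w0 f0//.
exists (rscale (f w / rdot w w) w) => x.
have : rdot w (x - rscale (f x / f w) w) = 0.
  by apply: orth => /=; rewrite fB fR divfK ?subrr// fw.
rewrite rdotBr rdotZr => /eqP; rewrite subr_eq0 => /eqP h.
rewrite rdotZr (rdotC x) h; field.
by rewrite w0 fw fx0.
Qed.

(** The functionals x |-> Re <T x, y> are represented by vectors S y; complex
linearity of T turns this into an identity of complex inner products. *)
Lemma adjoint_exists U W (T : U -> W) : blin T ->
  exists2 S, blin S & forall x y, inner (T x) y = inner x (S y).
Proof.
move=> bT; have [lT [C C0 hC]] := bT.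
have /choice[S hS] y : exists s, forall x, rdot (T x) y = rdot x s.
  apply: (riesz_representation (C := C * nrm y)) => [x x'|r x|x].
  - by rewrite blinD// rdotDl.
  - by rewrite blinR// rdotZl.
  - by rewrite (le_trans (cauchy_schwarz_norm _ _))// mulrAC ler_wpM2r ?nrm_ge0.
have TS x y : inner (T x) y = inner x (S y).
  rewrite !innerE hS; congr (_ +i* _); apply: oppr_inj.
  by rewrite -!rdot_iN -hS linZ.
exists S => //; split=> [a y z|].
  apply: rdot_eq => x.
  by rewrite rdotC -hS rdotDl rdotZc (rdotC (S y)) (rdotC (S z)) -!hS linZ// rdotZc conjcK -rdotDr.
exists C => // y.
have [->|] := eqVneq (nrm (S y)) 0; first by rewrite mulr_ge0 ?nrm_ge0.
move=> n0; have np : 0 < nrm (S y) by rewrite lt_neqAle nrm_ge0 eq_sym n0.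
rewrite -(ler_pM2l np) -expr2 -rdot_self -hS (le_trans (cauchy_schwarz _ _))//.
by rewrite mulrA ler_wpM2r ?nrm_ge0// (mulrC _ C).
Qed.

End Projections.

(** * The absolute value of a contraction *)

Section SquareRoot.
Local Open Scope complex_scope.
Variable R : realType.
Implicit Types U W : hilbertType R.

Lemma adjointP U W (T : U -> W) : blin T ->
  blin (adjoint T) /\ forall x y, inner (T x) y = inner x (adjoint T y).
Proof.
move=> bT; have [S bS hS] := adjoint_exists bT.
have hA : forall x y, inner (T x) y = inner x (adjoint T y).
  by apply: (@xgetPex _ (fun=> 0) [set S | forall x y, inner (T x) y = inner x (S y)]); exists S.
split => //; have -> // : adjoint T = S.
by apply/funext => y; apply: rdot_eq => x; rewrite ![rdot _ x]rdotC /rdot -hA hS.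
Qed.

Lemma blin_adjoint U W (T : U -> W) : blin T -> blin (adjoint T).
Proof. by case/adjointP. Qed.

Lemma inner_adjoint U W (T : U -> W) x y : blin T -> inner (T x) y = inner x (adjoint T y).
Proof. by case/adjointP => _ ->. Qed.

Lemma rdot_adjoint U W (T : U -> W) x y : blin T -> rdot (T x) y = rdot x (adjoint T y).
Proof. by move=> bT; rewrite /rdot inner_adjoint. Qed.

(** |T^* y|^2 = <T T^* y, y> <= |T^* y| |y|. *)
Lemma adjoint_contraction U W (T : U -> W) y : blin T ->
  (forall x, nrm (T x) <= nrm x) -> nrm (adjoint T y) <= nrm y.
Proof.
move=> bT hT; set v := adjoint T y.
have [->|n0] := eqVneq (nrm v) 0; first exact: nrm_ge0.
have np : 0 < nrm v by rewrite lt_neqAle nrm_ge0 eq_sym n0.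
rewrite -(ler_pM2l np) -expr2 -rdot_self -rdot_adjoint// (le_trans (cauchy_schwarz _ _))//.
by rewrite ler_wpM2r ?nrm_ge0.
Qed.

Lemma blin_cscale U (a : R[i]) : blin (fun x : U => a *: x).
Proof.
split=> [b x y|]; first by rewrite scalerDr !scalerA mulrC.
exists (complex.Re `|a|) => [|x]; first by rewrite -ler0c RRe_real// ger0_real.
by rewrite -lecR rmorphM/= (RRe_real (ger0_real (normr_ge0 a))) -!normE normrZ.
Qed.

Lemma blin_zero U W : blin (fun _ : U => 0 : W).
Proof.
split=> [a x y|]; first by rewrite scaler0 addr0.
by exists 0 => // x; rewrite nrm0 mul0r.
Qed.

Lemma ker_csubspace U W (T : U -> W) : blin T -> csubspace [set x | T x = 0].
Proof.
move=> bT; split=> [|x /= Tx]; last by rewrite blinZ// Tx scaler0.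
split=> /= [|x y Tx Ty|r x Tx|u l Tu ul].
- exact: blin0.
- by rewrite blinD// Tx Ty addr0.
- by rewrite blinR// Tx /rscale scaler0.
- apply: (sconv_unique (sconv_blin bT ul)).
  have -> : (fun n => T (u n)) = fun=> 0 by apply/funext => n; exact: Tu.
  exact: sconv_cst.
Qed.

Section Iteration.
Variables (U : hilbertType R) (T : U -> U).
Hypothesis bT : blin T.
Hypothesis hT : forall x, nrm (T x) <= nrm x.

(** The iteration Y -> (T + Y^2) / 2; its fixed points satisfy
(1 - Y)^2 = 1 - T. *)
Fixpoint sqrt_iter (n : nat) : U -> U :=
  if n is m.+1 then fun x => rscale 2^-1 (T x + sqrt_iter m (sqrt_iter m x))
  else fun=> 0.

(** The same iteration for the number 1 in the place of T: it majorizes the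
norms in the operator iteration. *)
Fixpoint sqrt_bound (n : nat) : R :=
  if n is m.+1 then 2^-1 * (1 + sqrt_bound m ^+ 2) else 0.

Local Notation Y := sqrt_iter.
Local Notation y := sqrt_bound.

Lemma sqrt_iter_blin n : blin (Y n).
Proof.
elim: n => [|n IHn] /=; first exact: blin_zero.
by apply: blin_scale; apply: blin_add => //; exact: blin_comp.
Qed.

Lemma sqrt_bound01 n : 0 <= y n <= 1.
Proof.
elim: n => [|n /andP[y0 y1]] /=; first by rewrite lexx ler01.
by apply/andP; split; nra.
Qed.

Lemma half_ge0 : 0 <= 2^-1 :> R. Proof. by rewrite invr_ge0. Qed.

Lemma sqrt_iter_le n x : nrm (Y n x) <= y n * nrm x.
Proof.
elim: n x => [|n IHn] x /=; first by rewrite nrm0 mul0r.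
rewrite nrmZ ger0_norm ?half_ge0// -mulrA ler_wpM2l ?half_ge0//.
rewrite (le_trans (nrmD _ _))// mulrDl mul1r lerD//.
rewrite (le_trans (IHn _))// expr2 -mulrA ler_wpM2l//.
by have /andP[] := sqrt_bound01 n.
Qed.

(** Y'^2 - Y^2 = Y' (Y' - Y) + (Y' - Y) Y: the increments are dominated by those
of the numerical iteration, for a contraction T that need not be positive. *)
Lemma sqrt_iterS n x : nrm (Y n.+1 x - Y n x) <= (y n.+1 - y n) * nrm x.
Proof.
elim: n x => [|n IHn] x.
  rewrite /= addr0 !subr0 nrmZ ger0_norm ?half_ge0//.
  by rewrite expr0n addr0 mulr1 ler_wpM2l ?half_ge0.
have step z : Y n.+2 z - Y n.+1 z =
    rscale 2^-1 (Y n.+1 (Y n.+1 z - Y n z) + (Y n.+1 (Y n z) - Y n (Y n z))).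
  rewrite [in LHS]/= -[in RHS]/(Y n.+1) -scalerBr; congr (_ *: _).
  by rewrite (blinB (sqrt_iter_blin n.+1)) addrA subrK opprD addrACA subrr add0r.
rewrite step nrmZ ger0_norm ?half_ge0//.
have -> : (y n.+2 - y n.+1) * nrm x = 2^-1 * ((y n.+1 * ((y n.+1 - y n) * nrm x)) +
   (y n.+1 - y n) * (y n * nrm x)).
  have -> : y n.+2 - y n.+1 = 2^-1 * (y n.+1 ^+ 2 - y n ^+ 2) by rewrite /=; ring.
  ring.
have /andP[y0 y1] := sqrt_bound01 n.+1.
rewrite ler_wpM2l ?half_ge0// (le_trans (nrmD _ _))// lerD//.
  by rewrite (le_trans (sqrt_iter_le _ _))// ler_wpM2l.
rewrite (le_trans (IHn _))// ler_wpM2l//; last exact: sqrt_iter_le.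
have /andP[z0 z1] := sqrt_bound01 n.
rewrite /=; have := sqr_ge0 (1 - y n); rewrite sqrrB expr1n mul1r; lra.
Qed.

Lemma sqrt_bound_nondecreasing n : y n <= y n.+1.
Proof. by rewrite /=; have := sqr_ge0 (1 - y n); rewrite sqrrB expr1n mul1r; lra. Qed.

Lemma sqrt_iter_cauchy n m x : (n <= m)%N ->
  nrm (Y m x - Y n x) <= (y m - y n) * nrm x.
Proof.
elim: m => [|m IHm]; first by rewrite leqn0 => /eqP->; rewrite !subrr nrm0 mul0r.
rewrite leq_eqVlt => /orP[/eqP->|nm]; first by rewrite !subrr nrm0 mul0r.
have -> : Y m.+1 x - Y n x = (Y m.+1 x - Y m x) + (Y m x - Y n x) by rewrite addrA subrK.
have -> : y m.+1 - y n = (y m.+1 - y m) + (y m - y n) by rewrite addrA subrK.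
by rewrite (le_trans (nrmD _ _))// mulrDl lerD ?sqrt_iterS// IHm.
Qed.

(** The numerical iteration increases and stays below 1, so its increments are
summable. *)
Lemma sqrt_iter_cvg x : exists l, sconv (fun n => Y n x) l.
Proof.
have ynd : nondecreasing_seq y by apply/nondecreasing_seqP => n; exact: sqrt_bound_nondecreasing.
have yc : cvgn y.
  apply: nondecreasing_is_cvgn => //; exists 1 => _ [n _ <-].
  by have /andP[] := sqrt_bound01 n.
apply: (@cauchy_sconv _ _ _ (fun n => ((limn y - y n) * nrm x) ^+ 2)).
  have : (fun n => (limn y - y n) * nrm x) @ \oo --> (limn y - limn y) * nrm x.
    by apply: cvgM; [apply: cvgB => //; exact: cvg_cst|exact: cvg_cst].
  rewrite subrr mul0r => h; rewrite -[X in _ --> X](mulr0 0).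
  by under eq_fun do rewrite expr2; exact: cvgM.
move=> n m nm; have h : nrm (Y m x - Y n x) <= (limn y - y n) * nrm x.
  rewrite (le_trans (sqrt_iter_cauchy _ nm))// ler_wpM2r ?nrm_ge0// lerD2r.
  exact: nondecreasing_cvgn_le.
by rewrite rdot_self lerXn2r// nnegrE ?nrm_ge0// (le_trans (nrm_ge0 _) h).
Qed.

Lemma sqrt_iter_commute n S : blin S -> (forall x, S (T x) = T (S x)) ->
  forall x, S (Y n x) = Y n (S x).
Proof.
move=> bS ST; elim: n => [|n IHn] x /=; first exact: blin0.
by rewrite blinR// blinD// ST !IHn.
Qed.

Lemma sqrt_iter_rsa n : rsa T -> rsa (Y n).
Proof.
move=> sT; elim: n => [|n IHn] x z /=; first by rewrite rdot0l rdot0r.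
by rewrite rdotZl rdotZr !rdotDl !rdotDr sT !IHn.
Qed.

(** The limit L of the iteration is the fixed point, that is
(1 - L)^2 = 1 - T, and it inherits from the iterates that it commutes with
everything that commutes with T. *)
Lemma sqrt_limit : exists L, [/\ blin L, rsa T -> rsa L,
  forall x, nrm (L x) <= nrm x,
  forall x, T x = rscale 2 (L x) - L (L x) &
  forall S, blin S -> (forall x, S (T x) = T (S x)) -> forall x, S (L x) = L (S x)].
Proof.
have /choice[L hL] := sqrt_iter_cvg.
have Y1 n x : nrm (Y n x) <= nrm x.
  rewrite (le_trans (sqrt_iter_le _ _))// ler_piMl ?nrm_ge0//.
  by have /andP[] := sqrt_bound01 n.
have L1 x : nrm (L x) <= nrm x by apply: sconv_nrm_le (hL x) _ => n.
have lL : linear L.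
  move=> a x z; apply: (sconv_unique (hL _)).
  have -> : (fun n => Y n (a *: x + z)) = (fun n => a *: Y n x + Y n z).
    by apply/funext => n; have [lY _] := sqrt_iter_blin n; rewrite lY.
  by apply: sconvD => //; apply: (sconv_blin (f := fun v => a *: v)); [exact: blin_cscale|].
have bL : blin L by split => //; exists 1 => // x; rewrite mul1r.
exists L; split => //.
- move=> sT x z; have h := sconv_rdot (y := z) (hL x).
  have h' := sconv_rdot (y := x) (hL z).
  rewrite -(cvg_lim _ h)// rdotC -(cvg_lim _ h')//; congr (lim (_ @ \oo)).
  by apply/funext => n; rewrite (sqrt_iter_rsa n sT) rdotC.
- move=> x.
  have hLL : sconv (fun n => Y n (Y n x)) (L (L x)).
    apply: (squeeze0 (b := fun n => nrm (Y n x - L x) + nrm (Y n (L x) - L (L x)))) => [n|].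
      rewrite nrm_ge0/=.
      have -> : Y n (Y n x) - L (L x) = Y n (Y n x - L x) + (Y n (L x) - L (L x)).
        by rewrite (blinB (sqrt_iter_blin n)) addrA subrK.
      by rewrite (le_trans (nrmD _ _))// lerD.
    by rewrite -[X in _ --> X](addr0 0); apply: cvgD; exact: hL.
  have h1 : sconv (fun n => Y n.+1 x) (L x).
    by rewrite /sconv (cvg_shiftS (fun n => nrm (Y n x - L x))); exact: hL.
  have h2 : sconv (fun n => Y n.+1 x) (rscale 2^-1 (T x + L (L x))).
    apply: (sconv_blin (f := fun v => rscale 2^-1 v)); first exact: blin_cscale.
    by apply: sconvD => //; exact: sconv_cst.
  rewrite {1}(sconv_unique h1 h2) /rscale scalerA -rmorphM/= divff ?pnatr_eq0// scale1r.
  by rewrite addrK.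
- move=> S bS ST x; apply: (sconv_unique (sconv_blin bS (hL x))).
  have -> : (fun n => S (Y n x)) = (fun n => Y n (S x)).
    by apply/funext => n; exact: sqrt_iter_commute.
  exact: hL.
Qed.

End Iteration.

(** Apply the iteration to T = 1 - Z^* Z, which is a contraction because
|T x|^2 <= |x|^2 - |Z x|^2, and take S = 1 - L. *)
Lemma absolute_value_exists U W (Z : U -> W) : blin Z ->
  (forall x, nrm (Z x) <= nrm x) ->
  exists S, [/\ blin S, rsa S, forall x, 0 <= rdot (S x) x,
    forall x, S (S x) = adjoint Z (Z x) &
    forall T, blin T -> (forall x, T (adjoint Z (Z x)) = adjoint Z (Z (T x))) ->
      forall x, T (S x) = S (T x)].
Proof.
move=> bZ hZ; have bA := blin_adjoint bZ.
have bZZ : blin (fun x => adjoint Z (Z x)) by exact: blin_comp.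
have bT : blin (fun x => x - adjoint Z (Z x)) by apply: blin_sub => //; exact: blin_id.
have Zq x y : rdot (adjoint Z (Z x)) y = rdot (Z x) (Z y).
  by rewrite rdotC -rdot_adjoint// rdotC.
have hT x : nrm (x - adjoint Z (Z x)) <= nrm x.
  apply: ler_nrm; rewrite !rdotE !(rdotC x) !Zq.
  have := ler_rdot (adjoint_contraction (Z x) bZ hZ).
  have := ler_rdot (hZ x); have := rdot_ge0 (Z x).
  rewrite !Zq; lra.
(* 1 - Z^* Z = 2 L - L^2, that is (1 - L)^2 = Z^* Z. *)
have [L [bL sL L1 TL cL]] := sqrt_limit bT hT.
have sT : rsa (fun x => x - adjoint Z (Z x)).
  by move=> x y; rewrite rdotBl rdotBr Zq (rdotC x (adjoint Z _)) Zq (rdotC (Z y)).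
exists (fun x => x - L x); split.
- by apply: blin_sub => //; exact: blin_id.
- by move=> x y; rewrite rdotBl rdotBr (sL sT).
- move=> x; rewrite rdotBl subr_ge0 (le_trans (cauchy_schwarz _ _))// rdot_self expr2.
  by rewrite ler_wpM2r ?nrm_ge0.
- move=> x; rewrite (blinB bL) -[adjoint Z (Z x)](subKr x) TL.
  rewrite /rscale rmorph_nat scaler_nat mulr2n !opprB opprD !addrA.
  by congr (_ - _); rewrite addrAC.
- move=> T' bT' hT' x; rewrite blinB// cL// => z.
  by rewrite blinB// hT'.
Qed.

(** The imaginary part of <S x, x> is <S x, i x>, and moving S and i across
changes its sign. *)
Lemma rsa_inner_real U (S : U -> U) x : linear S -> rsa S ->
  inner (S x) x = (rdot (S x) x)%:C.
Proof.
move=> lS sS; rewrite innerE; congr (_ +i* _).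
have : rdot (S x) ('i *: x) = - rdot (S x) ('i *: x).
  by rewrite {1}sS linZ// (rdotC (S x)) rdot_iN opprK.
lra.
Qed.

(** For w = |X| x - x with X^* X x = x one has |X| w = - w; positivity of |X|
gives w = 0. *)
Lemma opabs_eigenvalue1 U W (X : U -> W) : blin X -> (forall x, nrm (X x) <= nrm x) ->
  is_eigenvalue (opabs X) 1 <-> exists2 x, x != 0 & adjoint X (X x) = x.
Proof.
move=> bX hX.
have [S0 [bS0 sS0 pS0 qS0 _]] := absolute_value_exists bX hX.
pose Q := [set S : U -> U | [/\ linear S, continuous S,
    (forall x, 0 <= inner (S x) x) & (forall x, S (S x) = adjoint X (X x))]].
have [lS cS pS qS] : Q (opabs X).
  apply: (@xgetPex _ (fun=> 0) Q); exists S0; split => //.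
  - by case: bS0.
  - exact: blin_continuous.
  - by move=> x; rewrite rsa_inner_real ?ler0c//; case: bS0.
split=> [[x x0 Sx]|[x x0 XXx]].
  by exists x => //; rewrite -qS Sx scale1r Sx scale1r.
exists x => //; rewrite scale1r; apply/eqP; rewrite -subr_eq0; apply/eqP.
set w := _ - x.
have Sw : opabs X w = - w.
  by rewrite /w -[X in _ (_ + X)]scaleN1r linD// linZ// qS XXx !scaleN1r opprB.
have := pS w; rewrite Sw -scaleN1r innerZl mulN1r inner_self.
rewrite -rmorphN/= ler0c oppr_ge0 => h.
apply: nrm_eq0; apply/eqP; rewrite -sqrf_eq0; apply/eqP/le_anti.
by rewrite h sqr_ge0.
Qed.

End SquareRoot.

(** * Positive operators and the spectral family *)

Section PositiveOperators.
Local Open Scope complex_scope.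
Variable R : realType.
Implicit Types U W : hilbertType R.

Lemma blin_bound U W (T : U -> W) : blin T ->
  exists2 C : R, 0 < C & forall x, nrm (T x) <= C * nrm x.
Proof.
case=> _ [C C0 hC]; exists (C + 1) => [|x]; first by rewrite ltr_wpDl.
by rewrite (le_trans (hC x))// ler_wpM2r ?nrm_ge0// lerDl.
Qed.

(** Positivity at z - C^-1 T z, together with <T T z, T z> <= C |T z|^2. Only the
restriction of T to an invariant set K has to be positive. *)
Lemma psd_bound U (T : U -> U) (K : set U) (C : R) : blin T -> rsa T -> 0 < C ->
  (forall z, K z -> nrm (T z) <= C * nrm z) ->
  (forall z r, K z -> K (z + rscale r (T z))) -> (forall z, K z -> K (T z)) ->
  (forall z, K z -> 0 <= rdot (T z) z) ->
  forall z, K z -> rdot (T z) (T z) <= C * rdot (T z) z.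
Proof.
move=> bT sT C0 hC KT KT' pos z Kz.
have := pos _ (KT z (- C^-1) Kz).
have TT : rdot (T (T z)) (T z) <= C * rdot (T z) (T z).
  rewrite (le_trans (cauchy_schwarz _ _))// rdot_self expr2 mulrA ler_wpM2r ?nrm_ge0//.
  exact/hC/KT'.
rewrite blinD// blinR// !rdotE (sT (T z) z).
set p := rdot (T z) z; set q := rdot (T z) (T z) in TT *.
set s := rdot (T (T z)) (T z) in TT *.
have Ci0 : 0 < C^-1 by rewrite invr_gt0.
have CC : C^-1 * C = 1 by rewrite mulVf// gt_eqF.
move=> h.
have h1 : 0 <= C^-1 * (C^-1 * (C * q - s)) by rewrite !mulr_ge0 ?subr_ge0 ?(ltW Ci0).
have h2 : 0 <= p - C^-1 * q.
  have -> : p - C^-1 * q = (p + - C^-1 * q + (- C^-1 * q + - C^-1 * (- C^-1 * s))) +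
     C^-1 * (C^-1 * (C * q - s)) by rewrite mulrBr !mulrA CC; ring.
  exact: addr_ge0.
have := mulr_ge0 (ltW C0) h2.
by rewrite mulrBr mulrA mulrC [X in _ - X * _]mulrC CC mul1r subr_ge0 mulrC.
Qed.

Lemma psd_eq0 U (T : U -> U) (K : set U) : blin T -> rsa T ->
  (forall z r, K z -> K (z + rscale r (T z))) -> (forall z, K z -> K (T z)) ->
  (forall z, K z -> 0 <= rdot (T z) z) ->
  forall z, K z -> rdot (T z) z = 0 -> T z = 0.
Proof.
move=> bT sT KT KT' pos z Kz Tz; have [C C0 hC] := blin_bound bT.
have := psd_bound bT sT C0 (fun z _ => hC z) KT KT' pos Kz; rewrite Tz mulr0 => h.
by apply: rdot_eq0; apply/le_anti; rewrite h rdot_ge0.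
Qed.

Lemma psd_eq0T U (T : U -> U) : blin T -> rsa T ->
  (forall z, 0 <= rdot (T z) z) -> forall z, rdot (T z) z = 0 -> T z = 0.
Proof. by move=> bT sT pos z; apply: (@psd_eq0 U T setT). Qed.

(** P T P = T P implies P T = P T P = T P by taking adjoints. *)
Lemma oproj_commute U (P T : U -> U) : oproj P -> rsa T ->
  (forall x, P (T (P x)) = T (P x)) -> forall x, P (T x) = T (P x).
Proof.
move=> hP sT PTP x; have sP := oproj_rsa hP; apply: rdot_eq => y.
by rewrite sP sT -PTP -sP -sT -sP PTP.
Qed.

Lemma blin_shift U (B : U -> U) a : blin B -> blin (fun x => B x - rscale a x).
Proof. by move=> bB; apply: blin_sub => //; apply: (blin_scale a (blin_id U)). Qed.

Lemma rsa_shift U (B : U -> U) a : rsa B -> rsa (fun x => B x - rscale a x).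
Proof. by move=> sB x y; rewrite rdotBl rdotBr sB rdotZl rdotZr. Qed.

Lemma rscaleA U r s (x : U) : rscale r (rscale s x) = rscale (r * s) x.
Proof. by rewrite /rscale scalerA -rmorphM. Qed.

(** With C = B - a, the projection P onto the kernel of the positive part
|C| + C: on it C = - |C|, and on its complement, the closure of the range of
|C| + C, one has C = |C| because (|C| - C) (|C| + C) = 0. The factor M^-1
makes C a contraction, as the absolute value was constructed for these. *)
Lemma spectral_split U (B : U -> U) (a : R) : blin B -> rsa B ->
  exists P, [/\ oproj P,
    forall T, blin T -> rsa T -> (forall x, T (B x) = B (T x)) ->
      forall x, P (T x) = T (P x),
    forall x, P x = x -> rdot (B x) x <= a * rdot x x &
    forall x, P x = 0 -> x != 0 -> a * rdot x x < rdot (B x) x].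
Proof.
move=> bB sB; pose C x := B x - rscale a x.
have bC : blin C by exact: blin_shift.
have sC : rsa C by exact: rsa_shift.
have [M M0 hM] := blin_bound bC; have Mi0 : 0 < M^-1 by rewrite invr_gt0.
pose Z x := rscale M^-1 (C x).
have bZ : blin Z by exact: blin_scale.
have sZ : rsa Z by move=> x y; rewrite rdotZl rdotZr sC.
have hZ x : nrm (Z x) <= nrm x.
  by rewrite nrmZ gtr0_norm// ler_pdivrMl.
have ZE x : adjoint Z x = Z x by apply: rdot_eq => y; rewrite rdotC -rdot_adjoint// sZ rdotC.
have [S [bS sS pS SS cS]] := absolute_value_exists bZ hZ.
have {}SS x : S (S x) = Z (Z x) by rewrite SS ZE.
have {}cS T : blin T -> (forall x, T (Z x) = Z (T x)) -> forall x, T (S x) = S (T x).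
  by move=> bT TZ; apply: cS => // x; rewrite !ZE !TZ.
have SZ x : Z (S x) = S (Z x) by exact: cS.
pose D x := S x + Z x.
have bD : blin D by exact: blin_add.
have sD : rsa D by move=> x y; rewrite rdotDl rdotDr sS sZ.
have [P [hP KP PK]] := projection_theorem (ker_csubspace bD).
have CZ x : rdot (C x) x = M * rdot (Z x) x by rewrite rdotZl mulrA divff ?mul1r// gt_eqF.
have qC x : rdot (B x) x - a * rdot x x = M * rdot (Z x) x.
  by rewrite -CZ rdotBl rdotZl.
exists P; split => //.
- move=> T bT sT TB.
  have TZ x : T (Z x) = Z (T x) by rewrite /Z blinR// /C blinB// blinR// TB.
  have TS := cS _ bT TZ.
  apply: oproj_commute => // x; apply: PK => /=.
  by rewrite /D -TS -TZ -blinD// [S _ + _](KP x) blin0.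
- move=> x Px; have Dx : D x = 0 by rewrite -Px; exact: KP.
  have -> : rdot (B x) x = (rdot (B x) x - a * rdot x x) + a * rdot x x by rewrite subrK.
  rewrite gerDr qC pmulr_rle0//.
  have -> : Z x = - S x by apply/eqP; rewrite -addr_eq0 addrC; apply/eqP.
  by rewrite rdotNl oppr_le0.
- move=> x Px x0; rewrite -subr_gt0 qC pmulr_rgt0//.
  have SZx : S x = Z x.
    apply/eqP; rewrite -subr_eq0; apply/eqP/rdot_eq => w.
    (* S - Z maps into Ker D = Ker (S + Z), as S commutes with Z and S^2 = Z^2. *)
    have Kw : P (S w - Z w) = S w - Z w.
      by apply: PK; rewrite /= /D (blinB bS) (blinB bZ) SS SZ addrC addrA subrK subrr.
    rewrite rdot0l rdotBl sS sZ -rdotBr -Kw -(oproj_rsa hP) Px rdot0l//.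
  rewrite lt_neqAle -{2}SZx pS andbT eq_sym.
  apply: contra x0 => /eqP h.
  have Sx : S x = 0 by apply: (psd_eq0T bS sS pS); rewrite SZx.
  by rewrite -Px PK//= /D -SZx Sx addr0.
Qed.

End PositiveOperators.

(** * Stieltjes measures and their first moments *)

Section Stieltjes.
Local Open Scope complex_scope.
Variable R : realType.
Implicit Types U W : hilbertType R.

Lemma stieltjes_measure (f : R -> R) (nd : nondecreasing f)
  (rc : forall x, f t @[t --> x^'+] --> f x) :
  exists nu : {measure set (measurableTypeR R) -> \bar R},
   forall a b, a <= b -> nu `]a, b]%classic = (f b - f a)%:E.
Proof.
pose F : cumulative R R := HB.pack f (isCumulative.Build R _ R f nd rc).
exists (lebesgue_stieltjes_measure F) => a b ab.
rewrite /= /lebesgue_stieltjes_measure /measure_extension measurable_mu_extE/=; last exact: is_ocitv.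
by rewrite wlength_itv_bnd.
Qed.

Lemma open_ray_setI : setI_closed (@RGenOInfty.G R).
Proof.
move=> _ _ [a ->] [b ->]; exists (Num.max a b).
by apply/seteqP; split => t /=; rewrite !in_itv/= !andbT gt_max => /andP.
Qed.

(** The open rays form a pi-system that generates the Borel sets. *)
Lemma finite_measure_unique (m1 m2 : {measure set (measurableTypeR R) -> \bar R}) :
  (forall a, m1 `]a, +oo[%classic = m2 `]a, +oo[%classic) ->
  (forall a, (m1 `]a, +oo[%classic < +oo)%E) ->
  forall A, measurable A -> m1 A = m2 A.
Proof.
move=> m12 m1oo A mA.
apply: (@measure_unique _ R (measurableTypeR R) (@RGenOInfty.G R) (fun n => `]- n%:R, +oo[%classic) _ _ _ _ m1 m2) => //.
- exact: RGenOInfty.measurableE.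
- exact: open_ray_setI.
- by move=> n; exists (- n%:R).
- apply/seteqP; split => // t _; exists (Num.bound `|- t|) => //=.
  by rewrite in_itv/= andbT ltrNl; rewrite (le_lt_trans _ (archi_boundP (normr_ge0 (- t))))// ler_norm.
- by move=> _ [a ->].
Qed.

Section SupportedMeasure.
Variables (nu : {measure set (measurableTypeR R) -> \bar R}).
Variables (D : set (measurableTypeR R)) (M : R).
Hypothesis mD : measurable D.
Hypothesis nuoo : (nu setT < +oo)%E.
Hypothesis nuD : nu (~` D) = 0.
Hypothesis DM : forall t : R, D t -> `|t| <= M.

Lemma measurable_idR (A : set (measurableTypeR R)) :
  measurable_fun A (fun t : measurableTypeR R => (t : R)).
Proof. by move=> mA Y mY; apply: measurableI. Qed.

Lemma measurable_EFin_id (A : set (measurableTypeR R)) :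
  measurable_fun A (fun t : measurableTypeR R => (t : R)%:E).
Proof. by apply/measurable_EFinP; exact: measurable_idR. Qed.

Lemma supp_integrable : nu.-integrable setT (fun t : measurableTypeR R => (t : R)%:E).
Proof.
have [_ h] := negligible_integrable (measurableC mD) measurableT
  (@measurable_EFin_id setT) nuD.
apply: h.
rewrite setTD setCK.
apply: (@measurable_bounded_integrable _ _ _ nu (fun t : measurableTypeR R => (t : R))) => //.
- by rewrite (le_lt_trans _ nuoo)// le_measure ?inE.
- exists M; split; first exact: num_real.
  by move=> x Mx t /DM tM; exact: (le_trans tM (ltW Mx)).
Qed.

Lemma supp_cst_integrable (c : R) : nu.-integrable setT (fun t : measurableTypeR R => c%:E).
Proof.
apply: (@measurable_bounded_integrable _ _ _ nu (fun t : measurableTypeR R => c)) => //.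
exists `|c|; split; first exact: num_real.
by move=> x cx t _; rewrite ltW.
Qed.

(** The sign s serves for treating at once the bounds from above, s = 1, and from
below, s = -1. *)
Lemma supp_affine_integral (m r s a : R) : nu setT = m%:E ->
  (\int[nu]_t t%:E)%E = r%:E ->
  (\int[nu]_(t in D) (s * (a - t))%:E)%E = (s * (a * m - r))%:E.
Proof.
move=> num ir.
have i1 : nu.-integrable setT (fun t : measurableTypeR R => (a - (t : R))%:E).
  have := integrableB measurableT (supp_cst_integrable a) supp_integrable.
  by apply: eq_integrable.
have i2 : nu.-integrable setT (fun t : measurableTypeR R => (s * (a - (t : R)))%:E).
  by have := integrableZl measurableT s i1; apply: eq_integrable.
have -> : D = setT `\` ~` D by rewrite setTD setCK.
rewrite -(negligible_integral (measurableC mD) measurableT i2 nuD).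
under eq_integral do rewrite EFinM.
rewrite integralZl// integralB_EFin//; [|exact: supp_cst_integrable|exact: supp_integrable].
by rewrite ir integral_cst// num.
Qed.

Lemma supp_integral_bound (m r s a : R) : nu setT = m%:E ->
  (\int[nu]_t t%:E)%E = r%:E -> (forall t, D t -> 0 <= s * (a - t)) ->
  0 <= s * (a * m - r).
Proof.
move=> num ir pos; rewrite -lee_fin -(supp_affine_integral s a num ir).
by apply: integral_ge0 => t Dt; rewrite lee_fin pos.
Qed.

(** A positive function whose integral is 0 vanishes almost everywhere. *)
Lemma supp_integral_strict (m r s a : R) : nu setT = m%:E ->
  (\int[nu]_t t%:E)%E = r%:E -> (forall t, D t -> 0 < s * (a - t)) ->
  s * (a * m - r) = 0 -> m = 0.
Proof.
move=> num ir pos eq0.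
have := supp_affine_integral s a num ir; rewrite eq0 => i0.
have mf : measurable_fun D (fun t : measurableTypeR R => (s * (a - (t : R)))%:E).
  apply/measurable_EFinP; apply: measurable_funM; first exact: measurable_cst.
  by apply: measurable_funB; [exact: measurable_cst|exact: measurable_idR].
have : ae_eq nu D (fun t : measurableTypeR R => (s * (a - (t : R)))%:E) (cst 0%E).
  apply/ae_eq_integral_abs => //.
  rewrite -[RHS]i0; apply: eq_integral => t; rewrite inE => Dt.
  by rewrite gee0_abs// lee_fin ltW// pos.
case=> N [mN N0 sN].
have DN : D `<=` N.
  move=> t Dt; apply: sN => /= /(_ Dt) [] /eqP.
  by rewrite gt_eqF// pos.
have D0 : nu D = 0 by apply: (subset_measure0 mD mN DN).
have mDC := measurableC mD.
have : nu (D `|` ~` D) = 0.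
  have e : nu (D `|` ~` D) = (nu D + nu (~` D))%E by apply: measureU => //; rewrite setICr.
  by rewrite e D0 nuD adde0.
by rewrite setUv num => -[].
Qed.

End SupportedMeasure.

(** The measures nu1 and nu2 are carried by [-M, M] as well, which makes the
identity function integrable for all three. *)
Lemma supp_integral_add (nu nu1 nu2 : {measure set (measurableTypeR R) -> \bar R}) M :
  (nu setT < +oo)%E -> nu (~` `[-M, M]%classic) = 0 ->
  (forall A, measurable A -> nu A = (nu1 A + nu2 A)%E) ->
  (\int[nu]_t t%:E = \int[nu1]_t t%:E + \int[nu2]_t t%:E)%E.
Proof.
move=> nuoo nuM add.
have mM : measurable (~` `[-M, M]%classic : set (measurableTypeR R)) by exact: measurableC.
have DM (t : R) : `[-M, M]%classic t -> `|t| <= M by rewrite /= in_itv/= ler_norml.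
have [n1oo n2oo] : (nu1 setT < +oo /\ nu2 setT < +oo)%E.
  have := nuoo; rewrite add// => h; split; rewrite (le_lt_trans _ h)//.
    by rewrite leeDl.
  by rewrite leeDr.
have [n10 n20] : nu1 (~` `[-M, M]%classic) = 0 /\ nu2 (~` `[-M, M]%classic) = 0.
  have /eqP := nuM; rewrite add//.
  by rewrite padde_eq0// => /andP[/eqP-> /eqP->].
have i1 := supp_integrable (measurable_itv `[-M, M]) n1oo n10 DM.
have i2 := supp_integrable (measurable_itv `[-M, M]) n2oo n20 DM.
rewrite -(integral_measure_add measurableT i1 i2).
by apply: eq_measure_integral => A mA _; rewrite add//; exact: esym (measure_addE nu1 nu2 A).
Qed.

(** n < 2^n, and the order is archimedean. *)
Lemma le_halving_eq0 (x c : R) : 0 <= x -> (forall n : nat, x <= c / 2 ^+ n) -> x = 0.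
Proof.
move=> x0 xc; apply/eqP; rewrite eq_le x0 andbT leNgt; apply/negP => xp.
have c0 : 0 <= c by have := xc 0%N; rewrite expr0 divr1; apply: le_trans.
have := archi_boundP (divr_ge0 c0 x0); set n := Num.bound _ => h.
have := xc n; rewrite ler_pdivlMr ?exprn_gt0//; apply/negP; rewrite -ltNge.
rewrite mulrC -ltr_pdivrMr// (lt_trans h)// -natrX ltr_nat.
exact: ltn_expl.
Qed.

Section Bisection.
Variables (nu : {measure set (measurableTypeR R) -> \bar R}) (f : R -> R) (g : R -> R -> R) (M : R).
Hypothesis M0 : 0 <= M.
Hypothesis nuf : forall a b, a <= b -> nu `]a, b]%classic = (f b - f a)%:E.
Hypothesis nuT : nu setT = (f M - f (- M))%:E.
Hypothesis gD : forall a b c, a <= b -> b <= c -> g a c = g a b + g b c.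
Hypothesis gb : forall a b, a <= b -> a * (f b - f a) <= g a b <= b * (f b - f a).

Let MM : - M <= M. Proof. by rewrite (le_trans _ M0)// oppr_le0. Qed.

Let h a b : R := fine (\int[nu]_(t in `]a, b]%classic) t%:E).

Let mitv a b : measurable (`]a, b]%classic : set (measurableTypeR R)).
Proof. exact: measurable_itv. Qed.

Let nuC : nu (~` `]- M, M]%classic) = 0.
Proof.
pose I : set (measurableTypeR R) := `]- M, M]%classic.
have mI : measurable I by exact: mitv.
have mC := measurableC mI.
have e : nu (I `|` ~` I) = (nu I + nu (~` I))%E by apply: measureU => //; rewrite setICr.
rewrite -/I; move: e; rewrite setUv nuT nuf//.
case: (nu _) => [r| |] //= [] /eqP.
by rewrite eq_sym addrC -subr_eq0 addrK => /eqP->.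
Qed.

Let int_id : nu.-integrable setT (fun t : measurableTypeR R => (t : R)%:E).
Proof.
apply: (@supp_integrable _ `]- M, M]%classic M) => //; first by rewrite nuT ltry.
by move=> t /=; rewrite in_itv/= ler_norml => /andP[/ltW-> ->].
Qed.

Let int_itv a b : nu.-integrable `]a, b]%classic (fun t : measurableTypeR R => (t : R)%:E).
Proof. by apply: (integrableS measurableT). Qed.

Let hE a b : (\int[nu]_(t in `]a, b]%classic) t%:E)%E = (h a b)%:E.
Proof. by rewrite /h fineK//; apply: integrable_fin_num. Qed.

Let hD a b c : a <= b -> b <= c -> h a c = h a b + h b c.
Proof.
move=> ab bc; apply: EFin_inj; rewrite EFinD -!hE.
have -> : `]a, c]%classic = `]a, b]%classic `|` `]b, c]%classic :> set (measurableTypeR R).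
  apply/seteqP; split => t /=; rewrite !in_itv/=.
    by case/andP => at_ tc; have [tb|bt] := leP t b; [left; rewrite at_|right].
  case=> /andP[at_ tc]; rewrite ?at_ ?tc ?andbT/=; first exact: le_trans tc bc.
  exact: le_lt_trans ab at_.
rewrite integral_setU//.
apply/disj_setPS => t [] /=; rewrite !in_itv/= => /andP[_ tb] /andP[].
by rewrite ltNge tb.
Qed.

Let hb a b : a <= b -> a * (f b - f a) <= h a b <= b * (f b - f a).
Proof.
move=> ab.
have cint c : (\int[nu]_(t in `]a, b]%classic) c%:E)%E = (c * (f b - f a))%:E.
  by rewrite (integral_cst nu (mitv a b))// nuf.
have ci c : nu.-integrable `]a, b]%classic (fun t : measurableTypeR R => c%:E).
  by apply: (integrableS measurableT) => //; apply: supp_cst_integrable; rewrite nuT ltry.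
apply/andP; split; rewrite -lee_fin -cint -hE; apply: le_integral => // t.
  by rewrite inE/= in_itv/= => /andP[/ltW at_ _]; rewrite lee_fin.
by rewrite inE/= in_itv/= => /andP[_ tb]; rewrite lee_fin.
Qed.

Let bisect n a b : a <= b -> `|h a b - g a b| <= (b - a) / 2 ^+ n * (f b - f a).
Proof.
elim: n a b => [|n IHn] a b ab.
  have /andP[h1 h2] := hb ab; have /andP[g1 g2] := gb ab.
  by rewrite expr0 divr1 ler_norml; apply/andP; split; lra.
pose c := (a + b) / 2.
have ac : a <= c by rewrite /c; lra.
have cb : c <= b by rewrite /c; lra.
have -> : h a b - g a b = (h a c - g a c) + (h c b - g c b).
  by rewrite (hD ac cb) (gD ac cb); ring.
rewrite (le_trans (ler_normD _ _))//.
rewrite (le_trans (lerD (IHn _ _ ac) (IHn _ _ cb)))//.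
have e1 : (c - a) / 2 ^+ n = (b - a) / 2 ^+ n.+1.
  by rewrite exprS invfM /c; field; rewrite expf_neq0.
have e2 : (b - c) / 2 ^+ n = (b - a) / 2 ^+ n.+1.
  by rewrite exprS invfM /c; field; rewrite expf_neq0.
rewrite e1 e2 -mulrDr (_ : f c - f a + (f b - f c) = f b - f a)//; ring.
Qed.

(** Both the integral over ]a, b] and g are additive in the interval and lie
between a (f b - f a) and b (f b - f a). Bisecting the interval n times, the
difference of the two is at most 2^-n (b - a) (f b - f a). *)
Lemma integral_bisection : (\int[nu]_t t%:E)%E = (g (- M) M)%:E.
Proof.
have e : h (- M) M = g (- M) M.
  apply/eqP; rewrite -subr_eq0 -normr_eq0; apply/eqP.
  apply: (@le_halving_eq0 _ ((M - - M) * (f M - f (- M)))) => // n.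
  by rewrite (le_trans (bisect n MM))// mulrAC.
rewrite -e -hE.
rewrite (negligible_integral (measurableC (mitv (- M) M)) measurableT int_id nuC).
by rewrite setTD setCK.
Qed.

End Bisection.

Lemma measure_eventually (nu : {measure set (measurableTypeR R) -> \bar R})
    (A : nat -> set (measurableTypeR R)) c N :
  (forall n, measurable (A n)) -> nondecreasing_seq A ->
  (forall n, (N <= n)%N -> nu (A n) = c) -> nu (\bigcup_n A n) = c.
Proof.
move=> mA ndA Ac.
have h := nondecreasing_cvg_mu mA (bigcupT_measurable _ mA) ndA (mu := nu).
apply: (cvg_unique _ h) => //.
apply: cvg_near_cst; exists N => // n /= Nn; exact: Ac.
Qed.

(** The intervals ]a, a + n] and ]-n, n] exhaust a ray and the line, and f is
constant outside a bounded interval. *)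
Lemma bounded_stieltjes (f : R -> R) (r M : R) (nd : nondecreasing f)
  (rc : forall x, f t @[t --> x^'+] --> f x) :
  (forall a, a < - M -> f a = 0) -> (forall a, M <= a -> f a = r) ->
  exists nu : {measure set (measurableTypeR R) -> \bar R},
   [/\ forall a b, a <= b -> nu `]a, b]%classic = (f b - f a)%:E,
       forall a, nu `]a, +oo[%classic = (r - f a)%:E & nu setT = r%:E].
Proof.
move=> f0 fr; have [nu hnu] := stieltjes_measure nd rc.
have bnd (x : R) : x <= (Num.bound `|x|)%:R.
  by rewrite (le_trans (ler_norm x))// ltW// archi_boundP.
exists nu; split => // [a|].
  pose A n : set (measurableTypeR R) := `]a, a + n%:R]%classic.
  have -> : `]a, +oo[%classic = \bigcup_n A n.
    apply/seteqP; split => t /=; rewrite in_itv/= ?andbT.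
      move=> at_; exists (Num.bound `|t - a|) => //; rewrite /A /= in_itv/= at_/=.
      by rewrite addrC -lerBlDr bnd.
    by case=> n _; rewrite /A /= in_itv/= => /andP[].
  apply: (measure_eventually (N := Num.bound `|M - a|)) => [n|n m nm|n Nn].
  - exact: measurable_itv.
  - by apply/subsetPset => t; rewrite /A /= !in_itv/= => /andP[-> h]/=; rewrite (le_trans h)// lerD2l ler_nat.
  - rewrite /A hnu ?lerDl// fr// addrC -lerBlDr (le_trans (bnd _))// ler_nat//.
pose A n : set (measurableTypeR R) := `]- n%:R, n%:R]%classic.
have <- : \bigcup_n A n = setT.
  apply/seteqP; split => // t _; exists (Num.bound `|t|).+1 => //; rewrite /A /= in_itv/=.
  have h := archi_boundP (normr_ge0 t); have := bnd t.
  have : (Num.bound `|t|)%:R < (Num.bound `|t|).+1%:R :> R by rewrite ltr_nat.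
  move: h; rewrite ltr_norml => /andP[h1 h2] h3 h4.
  by apply/andP; split; [rewrite (le_lt_trans _ h1)// lerN2 ltW|rewrite ltW// (lt_trans h2)].
apply: (measure_eventually (N := (Num.bound `|M|).+1)) => [n|n m nm|n Nn].
- exact: measurable_itv.
- apply/subsetPset => t; rewrite /A /= !in_itv/= => /andP[h1 h2].
  by rewrite (le_trans h2) ?ler_nat// (le_lt_trans _ h1)// lerN2 ler_nat.
- have Mn : M < n%:R by rewrite (le_lt_trans (bnd M))// ltr_nat.
  have nn : - n%:R <= n%:R :> R by rewrite ge0_cp.
  by rewrite /A hnu// fr ?f0 ?subr0 ?ltrN2// ltW.
Qed.
End Stieltjes.

(** * Sums and limits of orthogonal projections *)

Section ProjectionLattice.
Local Open Scope complex_scope.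
Variable R : realType.
Implicit Types U W : hilbertType R.

(** Polarization. *)
Lemma quad_eq0 U (T : U -> U) : blin T -> rsa T -> (forall x, rdot (T x) x = 0) ->
  forall x, T x = 0.
Proof.
move=> bT sT h x; apply: rdot_eq => y; rewrite rdot0l.
have := h (x + y); rewrite blinD// rdotDl !rdotDr !h (sT y) (rdotC y); lra.
Qed.

Lemma quad_eq U (T S : U -> U) : blin T -> rsa T -> blin S -> rsa S ->
  (forall x, rdot (T x) x = rdot (S x) x) -> forall x, T x = S x.
Proof.
move=> bT sT bS sS h x; apply/eqP; rewrite -subr_eq0; apply/eqP.
apply: (@quad_eq0 _ (fun x => T x - S x)).
- exact: blin_sub.
- by move=> y z; rewrite rdotBl rdotBr sT sS.
- by move=> y; rewrite rdotBl h subrr.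
Qed.

(** The cross terms 2 <T P x, x - P x> vanish; as P x and x - P x may be chosen
independently, P T P = T P. *)
Lemma quad_commute U (T P : U -> U) : blin T -> rsa T -> oproj P ->
  (forall x, rdot (T x) x = rdot (T (P x)) (P x) + rdot (T (x - P x)) (x - P x)) ->
  forall x, P (T x) = T (P x).
Proof.
move=> bT sT hP h; have bP := oproj_blin hP; apply: oproj_commute => // u.
apply/esym/eqP; rewrite -subr_eq0; apply/eqP/rdot_eq => v; rewrite rdot0l.
have hQ := oproj_compl hP.
rewrite (oproj_rsa hQ) /=.
have := h (P u + (v - P v)).
have -> : P (P u + (v - P v)) = P u.
  by rewrite (blinD bP) (blinB bP) !(oproj_idem hP) subrr addr0.
have -> : P u + (v - P v) - P u = v - P v by rewrite addrC addKr.
move: (P u) (v - P v) => a b.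
by rewrite [T (a + b)](blinD bT) rdotDl !rdotDr (sT b a) (rdotC b (T a)); lra.
Qed.

Lemma oproj_quad_le0 U (P : U -> U) x : oproj P -> rdot (P x) x <= 0 -> P x = 0.
Proof.
move=> hP; rewrite oproj_quad// => h; apply: rdot_eq0.
by apply/le_anti; rewrite h rdot_ge0.
Qed.

Lemma oproj_quad_ge U (P : U -> U) x : oproj P -> rdot x x <= rdot (P x) x -> P x = x.
Proof.
move=> hP h; apply/esym/eqP; rewrite -subr_eq0; apply/eqP.
by apply: (oproj_quad_le0 (oproj_compl hP)); rewrite rdotBl subr_le0.
Qed.

Lemma oproj_id U : oproj (fun x : U => x).
Proof. by split => //; exact: blin_id. Qed.

Lemma oproj_0 U : oproj (fun _ : U => 0).
Proof. by split => //; [exact: blin_zero|move=> x y; rewrite rdot0l rdot0r]. Qed.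

Lemma oproj_add U (P Q : U -> U) : oproj P -> oproj Q -> (forall x, P (Q x) = 0) ->
  oproj (fun x => P x + Q x).
Proof.
move=> hP hQ PQ.
have QP x : Q (P x) = 0.
  by apply: rdot_eq => y; rewrite (oproj_rsa hQ) (oproj_rsa hP) PQ rdot0r rdot0l.
split.
- by apply: blin_add; [case: hP|case: hQ].
- move=> x; rewrite (blinD (oproj_blin hP)) (blinD (oproj_blin hQ)) PQ QP.
  by rewrite (oproj_idem hP) (oproj_idem hQ) addr0 add0r.
- by move=> x y; rewrite rdotDl rdotDr (oproj_rsa hP) (oproj_rsa hQ).
Qed.

Lemma oproj_comp U (P Q : U -> U) : oproj P -> oproj Q ->
  (forall x, P (Q x) = Q (P x)) -> oproj (fun x => P (Q x)).
Proof.
move=> hP hQ PQ; split.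
- by apply: blin_comp; [case: hP|case: hQ].
- by move=> x; rewrite PQ (oproj_idem hP) -PQ (oproj_idem hQ).
- by move=> x y; rewrite (oproj_rsa hP) (oproj_rsa hQ) PQ.
Qed.

Lemma oproj_mono U (P Q : U -> U) x : oproj P -> oproj Q ->
  (forall x, Q (P x) = P x) ->
  rdot (Q x - P x) (Q x - P x) = rdot (Q x) x - rdot (P x) x.
Proof.
move=> hP hQ QP.
have h : rdot (Q x) (P x) = rdot (P x) x.
  by rewrite (oproj_rsa hQ) QP rdotC.
by rewrite !rdotE (rdotC (P x) (Q x)) h -!oproj_quad//; ring.
Qed.

(** |S_m x - S_n x|^2 = <S_m x, x> - <S_n x, x>, and the numbers <S_n x, x>
increase and are bounded by |x|^2. *)
Lemma increasing_oproj U (S : nat -> U -> U) : (forall n, oproj (S n)) ->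
  (forall n m x, (n <= m)%N -> S m (S n x) = S n x) ->
  exists P, [/\ oproj P, forall x, sconv (fun n => S n x) (P x) &
    forall n x, S n (P x) = S n x].
Proof.
move=> hS mono.
pose f x n := rdot (S n x) x.
have fd x n m : (n <= m)%N -> rdot (S m x - S n x) (S m x - S n x) = f x m - f x n.
  by move=> nm; rewrite oproj_mono// => z; exact: mono.
have fnd x : nondecreasing_seq (f x).
  by move=> n m nm; rewrite -subr_ge0 -fd// rdot_ge0.
have fc x : cvgn (f x).
  apply: nondecreasing_is_cvgn => //; exists (rdot x x) => _ [n _ <-].
  by rewrite /f oproj_quad//; apply: ler_rdot; exact: oproj_le.
have /choice[P hP] x : exists l, sconv (fun n => S n x) l.
  apply: (@cauchy_sconv _ _ _ (fun n => limn (f x) - f x n)).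
    by rewrite -(subrr (limn (f x))); apply: cvgB => //; exact: cvg_cst.
  by move=> n m nm; rewrite fd// lerD2r nondecreasing_cvgn_le.
have mono' n m x : (n <= m)%N -> S n (S m x) = S n x.
  move=> nm; apply: rdot_eq => y.
  by rewrite (oproj_rsa (hS n)) (oproj_rsa (hS m)) mono// (oproj_rsa (hS n)).
have SP n x : S n (P x) = S n x.
  have h : sconv (fun m => S (m + n)%N x) (P x).
    by rewrite /sconv (cvg_shiftn n (fun n => nrm (S n x - P x))); exact: hP.
  apply: (sconv_unique (sconv_blin (oproj_blin (hS n)) h)).
  have -> : (fun m => S n (S (m + n)%N x)) = fun=> S n x.
    by apply/funext => m; rewrite mono'// leq_addl.
  exact: sconv_cst.
have lP : linear P.
  move=> a x z; apply: (sconv_unique (hP _)).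
  have -> : (fun n => S n (a *: x + z)) = (fun n => a *: S n x + S n z).
    by apply/funext => n; have [lY _] := oproj_blin (hS n); rewrite lY.
  by apply: sconvD => //; apply: (sconv_blin (f := fun v => a *: v)); [exact: blin_cscale|].
exists P; split => //; apply: orthogonal_projectionP; split => // [x|].
  by apply: (sconv_unique (hP _)); under eq_fun do rewrite SP; exact: hP.
apply: rsa_self_adjoint => // x z; have h := sconv_rdot (y := z) (hP x).
have h' := sconv_rdot (y := x) (hP z).
rewrite -(cvg_lim _ h)// rdotC -(cvg_lim _ h')//; congr (lim (_ @ \oo)).
by apply/funext => n; rewrite (oproj_rsa (hS n)) rdotC.
Qed.

End ProjectionLattice.

(** * Continuity of the spectral family *)

Section SpectralFamily.
Variables (R : realType) (U : hilbertType R) (B : U -> U) (E : R -> U -> U).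
Hypothesis bB : blin B.
Hypothesis sB : rsa B.
Hypothesis hE : forall a, oproj (E a).
Hypothesis EC : forall a T, blin T -> rsa T -> (forall x, T (B x) = B (T x)) ->
      forall x, E a (T x) = T (E a x).
Hypothesis Ele : forall a x, E a x = x -> rdot (B x) x <= a * rdot x x.
Hypothesis Egt : forall a x, E a x = 0 -> x != 0 -> a * rdot x x < rdot (B x) x.

Lemma family_commB a x : E a (B x) = B (E a x).
Proof. exact: EC. Qed.

Lemma family_comm a b x : E a (E b x) = E b (E a x).
Proof.
by apply: EC => [||y]; [case: (hE b)|case: (hE b)|rewrite family_commB].
Qed.

(** For z in the range of E(a) and the kernel of E(b), z <> 0, the value <B z, z> would
be at most a |z|^2 and greater than b |z|^2. *)
Lemma family_le a b x : a <= b -> E b (E a x) = E a x.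
Proof.
move=> ab; have bE c := oproj_blin (hE c).
apply/esym/eqP; rewrite -subr_eq0; apply/negPn/negP => z0.
set z := _ - _ in z0.
have Eaz : E a z = z.
  by rewrite /z (blinB (bE a)) family_comm (oproj_idem (hE a)).
have Ebz : E b z = 0 by rewrite /z (blinB (bE b)) (oproj_idem (hE b)) subrr.
have := Ele Eaz; rewrite leNgt => /negP; apply.
by rewrite (le_lt_trans _ (Egt Ebz z0))// ler_wpM2r ?rdot_ge0.
Qed.

Lemma family_bound : exists2 M, 0 < M &
  (forall a x, a < - M -> E a x = 0) /\ (forall a x, M <= a -> E a x = x).
Proof.
have [M M0 hM] := blin_bound bB; exists M => //.
have bE c := oproj_blin (hE c).
have q x : `|rdot (B x) x| <= M * rdot x x.
  by rewrite (le_trans (cauchy_schwarz_norm _ _))// rdot_self expr2 mulrA ler_wpM2r ?nrm_ge0.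
split=> a x aM.
  apply/eqP/negPn/negP => x0; have := Ele (oproj_idem (hE a) x).
  have := q (E a x); rewrite ler_norml => /andP[q1 _] q2.
  have : - (M * rdot (E a x) (E a x)) <= a * rdot (E a x) (E a x) by exact: le_trans q2.
  by rewrite -mulNr ler_pM2r ?rdot_gt0// leNgt aM.
apply/esym/eqP; rewrite -subr_eq0; apply/negPn/negP => z0.
have Ez : E a (x - E a x) = 0 by rewrite (blinB (bE a)) (oproj_idem (hE a)) subrr.
have := Egt Ez z0; rewrite ltNge => /negP; apply.
have := q (x - E a x); rewrite ler_norml => /andP[_ q1].
by rewrite (le_trans q1)// ler_wpM2r ?rdot_ge0.
Qed.

Let f x a := rdot (E a x) x.

Lemma family_nondecreasing x : nondecreasing (f x).
Proof.
move=> a b ab; rewrite -subr_ge0 -(oproj_mono _ (hE a) (hE b)) ?rdot_ge0// => z.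
exact: family_le.
Qed.

(** The E(a + 1/(n+1)) decrease to the projection onto the intersection of their
ranges. There <B z, z> <= a |z|^2, which excludes a component in the kernel
of E(a). *)
Lemma family_right_continuous x a : f x t @[t --> a^'+] --> f x a.
Proof.
have bE c := oproj_blin (hE c).
pose an n : R := a + n.+1%:R^-1.
have an_gt n : a < an n by rewrite ltrDl invr_gt0.
have an_le n m : (n <= m)%N -> an m <= an n by move=> nm; rewrite lerD2l lef_pV2 ?posrE// ler_nat.
have Emin b c z : b <= c -> E b (E c z) = E b z by move=> bc; rewrite family_comm family_le.
have [|n m z nm|P [hP cP SP]] := @increasing_oproj _ _ (fun n z => z - E (an n) z).
- by move=> n; exact: oproj_compl.
- rewrite (blinB (bE _)) Emin ?an_le//.
  by rewrite subrr subr0.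
pose y := x - P x.
have Ey n : E (an n) y = y.
  have := SP n y; rewrite /y (blinB (oproj_blin hP)) (oproj_idem hP) subrr (blin0 (bE _)) subr0.
  by move=> /eqP; rewrite eq_sym subr_eq0 => /eqP.
have Eay : E a y = E a x.
  have h : sconv (fun n => x - (x - E (an n) x)) y.
    apply: sconvD; first exact: sconv_cst.
    by apply: (sconv_blin (f := fun v => - v)) (cP x); apply: blin_opp; exact: blin_id.
  apply: (sconv_unique (sconv_blin (bE a) h)).
  have -> : (fun n => E a (x - (x - E (an n) x))) = fun=> E a x.
    by apply/funext => n; rewrite subKr Emin// ltW.
  exact: sconv_cst.
have yE : y = E a x.
  rewrite -Eay; apply/eqP; rewrite -subr_eq0; apply/negPn/negP => z0.
  have Ez : E a (y - E a y) = 0 by rewrite (blinB (bE a)) (oproj_idem (hE a)) subrr.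
  have := Egt Ez z0; rewrite ltNge => /negP; apply.
  apply/ler_addgt0Pr => e e0.
  set z := y - E a y in z0 Ez *.
  have zz : 0 < rdot z z by exact: rdot_gt0.
  set n := Num.bound `|rdot z z / e|.
  have hn : rdot z z * n.+1%:R^-1 <= e.
    rewrite ler_pdivrMr// mulrC -ler_pdivrMr// (le_trans (ler_norm _))// ltW//.
    by rewrite (lt_trans (archi_boundP _))// ltr_nat.
  have Enz : E (an n) z = z.
    by rewrite /z (blinB (bE _)) Ey (family_le _ (ltW (an_gt n))).
  rewrite (le_trans (Ele Enz))// /an mulrDl lerD2l mulrC//.
have conv : (fun n => f x (an n)) @ \oo --> f x a.
  rewrite /f -yE; have -> : (fun n => rdot (E (an n) x) x) =
    (fun n => rdot (x - (x - E (an n) x)) x) by apply/funext => n; rewrite subKr.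
  apply: sconv_rdot; apply: sconvD; first exact: sconv_cst.
  by apply: (sconv_blin (f := fun v => - v)) (cP x); apply: blin_opp; exact: blin_id.
apply/cvgrPdist_lt => e e0.
move/cvgrPdist_lt : conv => /(_ _ e0)[n _ /(_ n (leqnn n))] /=.
rewrite distrC ger0_norm ?subr_ge0 ?family_nondecreasing ?(ltW (an_gt n))// => hn.
near=> t.
have at_ : a < t by near: t; exact: nbhs_right_gt.
have ta : t < an n by near: t; apply: nbhs_right_lt.
rewrite distrC ger0_norm ?subr_ge0 ?family_nondecreasing ?(ltW at_)//.
by rewrite (le_lt_trans _ hn)// lerD2r family_nondecreasing// ltW.
Unshelve. all: by end_near. Qed.

End SpectralFamily.

(** * From the spectral family to a projection-valued measure *)

(** The measures nu x are given, and on rays their values are quadratic forms of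
projections; this extends to all Borel sets. *)
Section ProjectionMeasure.
Variables (R : realType) (U : hilbertType R).
Variable nu : U -> {measure set (measurableTypeR R) -> \bar R}.
Variable E : R -> U -> U.
Hypothesis hE : forall a, oproj (E a).
Hypothesis nuT : forall x, nu x setT = (rdot x x)%:E.
Hypothesis nuE : forall x a, nu x `]a, +oo[%classic = (rdot x x - rdot (E a x) x)%:E.

Lemma measure_disjointU (m : {measure set (measurableTypeR R) -> \bar R}) A B :
  measurable A -> measurable B -> A `&` B = set0 -> m (A `|` B) = (m A + m B)%E.
Proof. by move=> mA mB AB; apply: measureU. Qed.

(** A Dynkin argument. Disjoint sets have orthogonal projections, because
<P_i y, y> + <P_j y, y> <= |y|^2 for y in the range of P_j; so the partial
sums over a disjoint sequence are increasing projections. *)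
Lemma projection_of_set (D : set (measurableTypeR R)) : measurable D ->
  exists P, oproj P /\ forall x, nu x D = (rdot (P x) x)%:E.
Proof.
move=> mD.
pose C := [set D : set (measurableTypeR R) |
  exists P, oproj P /\ forall x, nu x D = (rdot (P x) x)%:E].
apply: (@dynkin_induction _ (measurableTypeR R) (@RGenOInfty.G R) C).
- exact: RGenOInfty.measurableE.
- exact: open_ray_setI.
- by exists (fun x => x); split; [exact: oproj_id|].
- move=> _ [a ->]; exists (fun x => x - E a x); split; first exact: oproj_compl.
  by move=> x; rewrite nuE rdotBl.
- move=> S mS [P [hP nP]]; exists (fun x => x - P x); split; first exact: oproj_compl.
  move=> x; have := measure_disjointU (nu x) mS (measurableC mS) (setICr S).
  rewrite setUv nuT nP rdotBl; case: (nu x (~` S)) => [r| |] //= [] ->.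
  by rewrite addrAC subrr add0r.
- move=> F mF tF /choice[P hP].
  have hP1 n : oproj (P n) by case: (hP n).
  have hP2 n x : nu x (F n) = (rdot (P n x) x)%:E by case: (hP n).
  have orth i j x : i != j -> P i (P j x) = 0.
    move=> ij; apply: oproj_quad_le0 => //.
    set y := P j x.
    have : (nu y (F i `|` F j) <= nu y setT)%E.
      by apply: le_measure; rewrite ?inE//; exact: measurableU.
    rewrite measure_disjointU//; last by have /trivIsetP := tF; apply.
    rewrite !hP2 nuT -EFinD lee_fin {2}/y (oproj_idem (hP1 j)) -/y.
    by rewrite gerDr.
  pose S := fix S n := if n is m.+1 then fun x => P m x + S m x else fun=> 0 : U.
  have PS n m x : (n <= m)%N -> P m (S n x) = 0.
    elim: n => [|n IHn] nm /=; first exact: (blin0 (oproj_blin (hP1 m))).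
    by rewrite (blinD (oproj_blin (hP1 m))) orth ?gtn_eqF// add0r IHn// ltnW.
  have hS n : oproj (S n).
    by elim: n => [|n IHn] /=; [exact: oproj_0|apply: oproj_add => // x; exact: PS].
  have SS n m x : (n <= m)%N -> S m (S n x) = S n x.
    elim: m => [|m IHm]; first by rewrite leqn0 => /eqP->.
    rewrite leq_eqVlt => /orP[/eqP->|nm]; first exact: oproj_idem.
    by rewrite /= PS// add0r IHm.
  have [Q [hQ cQ _]] := increasing_oproj hS SS.
  exists Q; split => // x.
  have h1 := measure_semi_sigma_additive F mF tF (bigcup_measurable (fun k _ => mF k)) (s := nu x).
  have h2 : (fun n => (\sum_(0 <= i < n) nu x (F i))%E) @ \oo --> (rdot (Q x) x)%:E.
    have -> : (fun n => (\sum_(0 <= i < n) nu x (F i))%E) = (fun n => (rdot (S n x) x)%:E).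
      apply/funext; elim => [|n IHn]; first by rewrite big_nil /= rdot0l.
      by rewrite big_nat_recr//= IHn hP2 -EFinD rdotDl addrC.
    by apply: cvg_EFin; [near=> n|exact: sconv_rdot].
  exact: (cvg_unique _ h1 h2).
- by move: mD; rewrite -[X in X D -> _]/((@ocitv R).-sigma.-measurable) RGenOInfty.measurableE.
Unshelve. all: by end_near. Qed.

Lemma projection_measure : exists F : set R -> U -> U, forall D, measurable D ->
  oproj (F D) /\ forall x, nu x D = (rdot (F D x) x)%:E.
Proof.
have /choice[F hF] : forall D : set R, exists P, measurable D ->
    oproj P /\ forall x, nu x D = (rdot (P x) x)%:E.
  move=> D; have [mD|nD] := pselect (measurable D); last by exists (fun=> 0).
  by have [P hP] := projection_of_set mD; exists P.
by exists F.
Qed.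

Variable F : set R -> U -> U.
Hypothesis hF : forall D, measurable D -> oproj (F D) /\ forall x, nu x D = (rdot (F D x) x)%:E.

Lemma projection_measureT x : F setT x = x.
Proof.
have [hP nP] := hF measurableT.
by apply: oproj_quad_ge => //; have := nP x; rewrite nuT => -[] ->.
Qed.

Lemma projection_measureU D D' : measurable D -> measurable D' -> D `&` D' = set0 ->
  forall x, F (D `|` D') x = F D x + F D' x.
Proof.
move=> mD mD' DD'.
have [h nh] := hF mD; have [h' nh'] := hF mD'; have [hu nu'] := hF (measurableU _ _ mD mD').
apply: (quad_eq (S := fun x => F D x + F D' x)).
- exact: oproj_blin.
- exact: oproj_rsa.
- by apply: blin_add; exact: oproj_blin.
- by move=> x y; rewrite rdotDl rdotDr (oproj_rsa h) (oproj_rsa h').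
- move=> x; apply: EFin_inj; rewrite -nu' rdotDl EFinD -nh -nh'.
  exact: measure_disjointU.
Qed.

Lemma projection_measure_disj D D' : measurable D -> measurable D' -> D `&` D' = set0 ->
  forall x, F D (F D' x) = 0.
Proof.
move=> mD mD' DD' x; have [h nh] := hF mD; have [h' nh'] := hF mD'.
have [hu _] := hF (measurableU _ _ mD mD').
apply: oproj_quad_le0 => //; set y := F D' x.
have := ler_rdot (oproj_le y hu); rewrite -oproj_quad// projection_measureU//.
by rewrite rdotDl {2}/y (oproj_idem h') -/y gerDr.
Qed.

(** Split D and D' along their intersection; projections of disjoint sets have
product 0. *)
Lemma projection_measureI D D' : measurable D -> measurable D' ->
  forall x, F (D `&` D') x = F D (F D' x).
Proof.
move=> mD mD' x.
have mI := measurableI _ _ mD mD'.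
have mA := measurableD mD mD'; have mA' := measurableD mD' mD.
have [h _] := hF mD; have [hI _] := hF mI.
have split1 A C y : measurable A -> measurable C -> F A y = F (A `&` C) y + F (A `\` C) y.
  move=> m1 m2; rewrite -projection_measureU ?setUIDK//; [exact: measurableI|exact: measurableD|].
  by rewrite setDE setIACA setICr setI0.
rewrite (split1 D' D)// (setIC D') (blinD (oproj_blin h)).
rewrite (@projection_measure_disj D (D' `\` D))//; last by rewrite setDE setICA setICr setI0.
rewrite addr0 (split1 D D')// (oproj_idem hI).
rewrite (@projection_measure_disj (D `\` D') (D `&` D'))// ?addr0//.
by rewrite setDE setIACA (setIC _ D') setICr setI0.
Qed.

End ProjectionMeasure.

(** * The spectral theorem *)

Section SpectralTheorem.
Variables (R : realType).
Implicit Type U : hilbertType R.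

(** The increments w = (E(b) - E(a)) x satisfy a |w|^2 <= <B w, w> <= b |w|^2, and
<B w, w> is additive in the interval as B commutes with the E(a): the
first moment follows by bisection. *)
Theorem spectral_theorem U (B : U -> U) : blin B -> rsa B ->
  exists F, is_spectral_measure B F.
Proof.
move=> bB sB.
have /choice[E hE0] := fun a => spectral_split a bB sB.
have hE a : oproj (E a) by case: (hE0 a).
have EC a T : blin T -> rsa T -> (forall x, T (B x) = B (T x)) ->
    forall x, E a (T x) = T (E a x) by case: (hE0 a) => _ + _ _; apply.
have Ele a x : E a x = x -> rdot (B x) x <= a * rdot x x by case: (hE0 a) => _ _ + _; apply.
have Egt a x : E a x = 0 -> x != 0 -> a * rdot x x < rdot (B x) x by case: (hE0 a) => _ _ _; apply.
have bE c := oproj_blin (hE c).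
have [M M0 [Elow Ehigh]] := family_bound bB hE Ele Egt.
have /choice[nu hnu] : forall x, exists nu : {measure set (measurableTypeR R) -> \bar R},
   [/\ forall a b, a <= b -> nu `]a, b]%classic = (rdot (E b x) x - rdot (E a x) x)%:E,
       forall a, nu `]a, +oo[%classic = (rdot x x - rdot (E a x) x)%:E &
       nu setT = (rdot x x)%:E].
  move=> x; apply: (@bounded_stieltjes R (fun a => rdot (E a x) x) _ M).
  - exact: (family_nondecreasing bB sB hE EC Ele Egt x).
  - by move=> a; exact: (family_right_continuous bB sB hE EC Ele Egt).
  - by move=> a aM; rewrite Elow// rdot0l.
  - by move=> a aM; rewrite Ehigh.
have nuT x : nu x setT = (rdot x x)%:E by case: (hnu x).
have nuE x a : nu x `]a, +oo[%classic = (rdot x x - rdot (E a x) x)%:E by case: (hnu x).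
have nuI x a b : a <= b -> nu x `]a, b]%classic = (rdot (E b x) x - rdot (E a x) x)%:E.
  by case: (hnu x) => + _ _; apply.
have [F hF] := projection_measure hE nuT nuE.
exists F; pose M1 := M + 1.
(* E vanishes strictly below -M only, hence the margin 1. *)
have M1M : M < M1 by rewrite ltrDl.
have M10 : 0 <= M1 by rewrite addr_ge0// ltW.
have E1 x : E M1 x = x by apply: Ehigh; exact: ltW.
have E0 x : E (- M1) x = 0 by apply: Elow; rewrite ltrN2.
split.
- by move=> D mD; have [h _] := hF D mD; exact: oprojP.
- exact: (projection_measureT nuT hF).
- by move=> D1 D2 mD1 mD2 x; exact: (projection_measureI hF).
- exists M1 => x; have [h nh] := hF _ (measurable_itv `[- M1, M1]).
  apply: oproj_quad_ge => //; rewrite -lee_fin -nh.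
  have <- : nu x `]- M1, M1]%classic = (rdot x x)%:E.
    by rewrite nuI ?ge0_cp// E1 E0 rdot0l subr0.
  apply: le_measure; rewrite ?inE; [exact: measurable_itv|exact: measurable_itv|].
  by move=> t /=; rewrite !in_itv/= => /andP[/ltW-> ->].
- move=> x; exists (nu x) => [D mD|].
    by have [_ ->] := hF D mD.
  have Ele' a b y : a <= b -> E b (E a y) = E a y by exact: (family_le bB sB hE EC Ele Egt).
  have Ege' a b y : a <= b -> E a (E b y) = E a y.
    by move=> ab; rewrite (family_comm bB sB hE EC)// Ele'.
  have EB a y : E a (B y) = B (E a y) by exact: EC.
  pose w a b := E b x - E a x.
  rewrite (@integral_bisection _ (nu x) (fun a => rdot (E a x) x)
     (fun a b => rdot (B (w a b)) (w a b)) M1) //.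
  + by rewrite /w E1 E0 subr0.
  + exact: nuI.
  + by rewrite nuT E1 E0 rdot0l subr0.
  + move=> a b c ab bc.
    have -> : w a c = w a b + w b c by rewrite /w [RHS]addrC addrA subrK.
    have Eu : E b (w b c) = 0 by rewrite /w (blinB (bE _)) Ege'// (oproj_idem (hE b)) subrr.
    have Ev : E b (w a b) = w a b by rewrite /w (blinB (bE _)) (oproj_idem (hE b)) Ele'.
    (* w a b is in the range of E b and w b c in its kernel, and E b commutes with B. *)
    have cross : rdot (B (w b c)) (w a b) = 0.
      by rewrite -Ev -(oproj_rsa (hE b)) EB Eu (blin0 bB) rdot0l.
    move: (w a b) (w b c) cross => u v cross.
    rewrite (blinD bB) rdotDl !rdotDr (sB u v) (rdotC u (B v)) !cross.
    ring.
  + move=> a b ab.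
    have ww : rdot (w a b) (w a b) = rdot (E b x) x - rdot (E a x) x.
      by apply: oproj_mono => // z; exact: Ele'.
    have Ev : E b (w a b) = w a b by rewrite /w (blinB (bE _)) (oproj_idem (hE b)) Ele'.
    have Eu : E a (w a b) = 0 by rewrite /w (blinB (bE _)) Ege'// (oproj_idem (hE a)) subrr.
    rewrite -ww Ele// andbT.
    have [->|w0] := eqVneq (w a b) 0; first by rewrite (blin0 bB) !rdot0l mulr0.
    exact/ltW/Egt.
Qed.

End SpectralTheorem.

(** * Uniqueness of the spectral measure and commutation *)

Section SpectralMeasure.
Variables (R : realType) (U : hilbertType R) (B : U -> U) (F : set R -> U -> U).
Hypothesis bB : blin B.
Hypothesis sB : rsa B.
Hypothesis hF : is_spectral_measure B F.

Lemma spectral_oproj D : measurable D -> oproj (F D).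
Proof. by move=> mD; exact/orthogonal_projectionP/(spectral_measure_proj hF). Qed.

Lemma spectral_nu x : exists2 nu : {measure set (measurableTypeR R) -> \bar R},
  (forall D : set R, measurable D -> nu D = (rdot (F D x) x)%:E) &
  (\int[nu]_t t%:E)%E = (rdot (B x) x)%:E.
Proof. exact: (spectral_measure_integral hF). Qed.

Lemma spectral_comm D D' x : measurable D -> measurable D' -> F D (F D' x) = F D' (F D x).
Proof. by move=> mD mD'; rewrite -!(spectral_measure_setI hF)// setIC. Qed.

(** Both sides are projections with the same quadratic form. *)
Lemma spectralC D x : measurable D -> F (~` D) x = x - F D x.
Proof.
move=> mD; have hD := spectral_oproj mD; have hC := spectral_oproj (measurableC mD).
apply: (quad_eq (S := fun x => x - F D x)).
- exact: oproj_blin.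
- exact: oproj_rsa.
- exact: oproj_blin (oproj_compl hD).
- exact: oproj_rsa (oproj_compl hD).
move=> y; have [nu nuD _] := spectral_nu y.
have := measure_disjointU nu mD (measurableC mD) (setICr D).
rewrite setUv !nuD//; last exact: measurableC.
rewrite (spectral_measure_setT hF) -EFinD => -[] h.
by rewrite rdotBl h addrC addKr.
Qed.

Lemma commuting_quad (P Q : U -> U) x : oproj P -> oproj Q ->
  (forall x, P (Q x) = Q (P x)) ->
  rdot (P x) x = rdot (P (Q x)) (Q x) + rdot (P (x - Q x)) (x - Q x).
Proof.
move=> hP hQ PQ; have bP := oproj_blin hP.
have e u v : rdot (P u) v = 0 -> rdot (P v) u = 0 ->
    rdot (P (u + v)) (u + v) = rdot (P u) u + rdot (P v) v.
  by move=> c1 c2; rewrite (blinD bP) rdotDl !rdotDr c1 c2; ring.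
rewrite -e ?[Q x + _]addrC ?subrK//; first by rewrite PQ (oproj_orth _ _ hQ).
by rewrite (oproj_rsa hP) PQ rdotC (oproj_orth _ _ hQ).
Qed.

Lemma spectral_support : exists M : R, forall D z, measurable D -> F D z = z ->
  forall nu : {measure set (measurableTypeR R) -> \bar R},
  (forall D : set R, measurable D -> nu D = (rdot (F D z) z)%:E) ->
  nu (~` (D `&` `[- M, M]%classic)) = 0.
Proof.
have [M hM] := spectral_measure_bounded hF; exists M => D z mD Dz nu nuE.
have mDM : measurable (D `&` `[- M, M]%classic) by apply: measurableI => //; exact: measurable_itv.
have mC := measurableC mDM.
rewrite nuE// spectralC// (spectral_measure_setI hF)//.
by rewrite hM Dz subrr rdot0l.
Qed.

Lemma spectral_bound D z (s a : R) : measurable D -> F D z = z ->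
  (forall t, D t -> 0 <= s * (a - t)) -> 0 <= s * (a * rdot z z - rdot (B z) z).
Proof.
move=> mD Dz pos; have [nu nuE ni] := spectral_nu z.
have [M hM] := spectral_support; have n0 := hM D z mD Dz nu nuE.
have nT : nu setT = (rdot z z)%:E by rewrite nuE// (spectral_measure_setT hF).
have mDM : measurable (D `&` `[- M, M]%classic) by apply: measurableI => //; exact: measurable_itv.
apply: (supp_integral_bound mDM _ n0 _ nT ni).
- by rewrite nT ltry.
- by move=> t [_]; rewrite /= in_itv/= -ler_norml; exact.
- by move=> t [/pos].
Qed.

(** If s (a |z|^2 - <B z, z>) = 0 with the integrand s (a - t) positive on D, the
measure of z has total mass 0. *)
Lemma spectral_strict D z (s a : R) : measurable D -> F D z = z ->
  (forall t, D t -> 0 < s * (a - t)) -> s * (a * rdot z z - rdot (B z) z) = 0 -> z = 0.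
Proof.
move=> mD Dz pos eq0; have [nu nuE ni] := spectral_nu z.
have [M hM] := spectral_support; have n0 := hM D z mD Dz nu nuE.
have nT : nu setT = (rdot z z)%:E by rewrite nuE// (spectral_measure_setT hF).
have mDM : measurable (D `&` `[- M, M]%classic) by apply: measurableI => //; exact: measurable_itv.
apply: rdot_eq0; apply: (supp_integral_strict mDM _ n0 _ nT ni _ eq0).
- by rewrite nT ltry.
- by move=> t [_]; rewrite /= in_itv/= -ler_norml; exact.
- by move=> t [/pos].
Qed.

(** The measure of x is the sum of those of F(D) x and x - F(D) x, hence so are
the first moments, and quad_commute applies. *)
Lemma spectral_commB D x : measurable D -> F D (B x) = B (F D x).
Proof.
move=> mD; have hP := spectral_oproj mD; apply: (@quad_commute _ _ B (F D) bB sB hP) => y.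
have [nu nuE ni] := spectral_nu y.
have [nu1 nuE1 ni1] := spectral_nu (F D y).
have [nu2 nuE2 ni2] := spectral_nu (y - F D y).
apply: EFin_inj; rewrite EFinD -ni -ni1 -ni2.
have [M hM] := spectral_support.
have := hM setT y measurableT (spectral_measure_setT hF y) nu nuE; rewrite setTI => n0.
apply: (supp_integral_add _ n0) => [|A mA].
  by rewrite nuE// ltry.
rewrite nuE// nuE1// nuE2// -EFinD -(commuting_quad _ (spectral_oproj mA) hP)// => z.
exact: spectral_comm.
Qed.

(** The projection of the ray is the projection P of spectral_split, which
commutes with everything that commutes with B: on the range of F(]-oo, a])
one has B <= a, on that of F(]a, +oo[) strictly B > a, and P and F
commute. *)
Lemma spectral_commute_ray (Q : U -> U) a x : blin Q -> rsa Q ->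
  (forall x, Q (B x) = B (Q x)) ->
  F `]-oo, a]%classic (Q x) = Q (F `]-oo, a]%classic x).
Proof.
move=> bQ sQ QB.
have mD : measurable (`]-oo, a]%classic : set R) by exact: measurable_itv.
have hD := spectral_oproj mD; have bD := oproj_blin hD.
have [P [hP PC Ple Pgt]] := spectral_split a bB sB.
have bP := oproj_blin hP.
have PF y : P (F `]-oo, a]%classic y) = F `]-oo, a]%classic (P y).
  by apply: PC => // [|z]; [exact: oproj_rsa|exact: spectral_commB].
suff PE y : F `]-oo, a]%classic y = P y by rewrite !PE; exact: PC.
have PFF : P (F `]-oo, a]%classic y) = F `]-oo, a]%classic y.
  apply/esym/eqP; rewrite -subr_eq0; apply/negPn/negP => z0.
  set z := _ - _ in z0.
  have Pz : P z = 0 by rewrite /z (blinB bP) (oproj_idem hP) subrr.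
  have Fz : F `]-oo, a]%classic z = z by rewrite /z (blinB bD) -PF (oproj_idem hD).
  have := spectral_bound (s := 1) (a := a) mD Fz; rewrite mul1r subr_ge0 => h.
  have := Pgt z Pz z0; rewrite ltNge h// => t; rewrite /= in_itv/= => ta.
  by rewrite mul1r subr_ge0.
rewrite -PFF PF; apply/eqP; rewrite -subr_eq0 -oppr_eq0 opprB; apply/eqP.
set z := _ - _.
have Pz : P z = z by rewrite /z (blinB bP) (oproj_idem hP) PF (oproj_idem hP).
have mC := measurableC mD.
have Fz : F (~` `]-oo, a]%classic) z = z.
  by rewrite spectralC// {2}/z (blinB bD) (oproj_idem hD) subrr subr0.
have pos t : (~` `]-oo, a]%classic) t -> 0 < -1 * (a - t).
  by rewrite /= in_itv/= mulN1r opprB subr_gt0 => /negP; rewrite -ltNge.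
apply: (spectral_strict (s := -1) (a := a) mC Fz pos).
have h1 : 0 <= -1 * (a * rdot z z - rdot (B z) z).
  by apply: (spectral_bound mC Fz) => t /pos/ltW.
apply/eqP; rewrite eq_le h1 andbT mulN1r oppr_le0 subr_ge0.
exact: Ple.
Qed.

(** By spectral_commute_ray the measures nu_x and nu_{Q x} + nu_{x - Q x} agree on
rays, hence on all Borel sets, and quad_commute applies. *)
Lemma spectral_commute (Q : U -> U) D x : oproj Q -> (forall x, Q (B x) = B (Q x)) ->
  measurable D -> F D (Q x) = Q (F D x).
Proof.
move=> hQ QB mD; have hD := spectral_oproj mD; apply/esym.
apply: (@quad_commute _ _ (F D) Q (oproj_blin hD) (oproj_rsa hD) hQ) => y.
have [nu nuE _] := spectral_nu y.
have [nu1 nuE1 _] := spectral_nu (Q y).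
have [nu2 nuE2 _] := spectral_nu (y - Q y).
apply: EFin_inj; rewrite EFinD -nuE// -nuE1// -nuE2//.
have -> : (nu1 D + nu2 D = measure_add nu1 nu2 D)%E by exact: esym (measure_addE nu1 nu2 D).
apply: finite_measure_unique => // a.
  have mr : measurable (`]a, +oo[%classic : set R) by exact: measurable_itv.
  transitivity (nu1 `]a, +oo[%classic + nu2 `]a, +oo[%classic)%E; last first.
    exact: esym (measure_addE nu1 nu2 _).
  rewrite nuE// nuE1// nuE2// -EFinD -(commuting_quad _ (spectral_oproj mr) hQ)// => z.
  have -> : `]a, +oo[%classic = ~` `]-oo, a]%classic :> set R by rewrite setCitvl.
  have mD' : measurable (`]-oo, a]%classic : set R) by exact: measurable_itv.
  rewrite !spectralC// (blinB (oproj_blin hQ)) spectral_commute_ray//.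
    by case: hQ.
  by case: hQ.
by rewrite nuE ?ltry//; exact: measurable_itv.
Qed.

End SpectralMeasure.

Lemma spectral_projectionP (R : realType) (U : hilbertType R) (B : U -> U) :
  blin B -> rsa B -> is_spectral_measure B (spectral_projection B).
Proof. by move=> bB sB; apply: xgetPex; exact: spectral_theorem. Qed.

(** * Suprema of quadratic forms, the spectrum, and the Lyapunov inequality *)

Section QuadraticFormBounds.
Local Open Scope complex_scope.
Variables (R : realType).
Implicit Type U : hilbertType R.

(** Let m be the supremum of <P z, z> / |z|^2 over K. If m - P were bounded
below on K, then psd_bound would make <(m - P) z, z> >= d |z|^2 with d > 0,
and m - d would be a smaller upper bound. *)
Lemma sup_quadratic_form U (P : U -> U) (K : set U) z0 : blin P -> rsa P ->
  (forall x y, K x -> K y -> K (x + y)) -> (forall r x, K x -> K (rscale r x)) ->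
  (forall x, K x -> K (P x)) -> K z0 -> z0 != 0 ->
  exists m : R, (forall z, K z -> rdot (P z) z <= m * rdot z z) /\
    forall c, 0 < c ->
      ~ forall z, K z -> c * rdot z z <= rdot (rscale m z - P z) (rscale m z - P z).
Proof.
move=> bP sP KD KR KP Kz0 z00; have [C C0 hC] := blin_bound bP.
pose S := [set r : R | exists2 z, K z /\ z != 0 & r = rdot (P z) z / rdot z z].
have S0 : S !=set0 by exists (rdot (P z0) z0 / rdot z0 z0), z0.
have SC : ubound S C.
  move=> _ [z [Kz z_neq0] ->]; rewrite ler_pdivrMr ?rdot_gt0//.
  by rewrite (le_trans (cauchy_schwarz _ _))// rdot_self expr2 mulrA ler_wpM2r ?nrm_ge0.
pose m := sup S.
have Pm z : K z -> rdot (P z) z <= m * rdot z z.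
  move=> Kz; have [->|z_neq0] := eqVneq z 0; first by rewrite (blin0 bP) rdot0l mulr0.
  rewrite -ler_pdivrMr ?rdot_gt0//; apply: ub_le_sup; first by exists C.
  by exists z.
exists m; split => // c c0 hc.
pose T z := rscale m z - P z.
have bT : blin T by apply: blin_sub => //; apply: (blin_scale m (blin_id U)).
have sT : rsa T by move=> x y; rewrite rdotBl rdotBr sP rdotZl rdotZr.
have KT z : K z -> K (T z).
  by move=> Kz; apply: KD; [exact: KR|rewrite -rscaleN1; apply: KR; exact: KP].
have posT z : K z -> 0 <= rdot (T z) z by move=> Kz; rewrite rdotBl rdotZl subr_ge0 Pm.
have [C' C'0 hC'] := blin_bound bT.
have bnd := psd_bound bT sT C'0 (fun z _ => hC' z) (fun z r Kz => KD _ _ Kz (KR r _ (KT z Kz))) KT posT.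
have : m <= m - c / C'.
  apply: ge_sup => // _ [z [Kz z_neq0] ->].
  rewrite ler_pdivrMr ?rdot_gt0// mulrBl lerBrDr addrC -lerBrDr.
  have -> : m * rdot z z - rdot (P z) z = rdot (T z) z by rewrite rdotBl rdotZl.
  rewrite mulrAC ler_pdivrMr// (mulrC _ C').
  exact: le_trans (hc z Kz) (bnd z Kz).
by rewrite lerBrDr gerDl leNgt divr_gt0.
Qed.

Lemma sup_form_not_regular U (A : U -> U) (l : R) x : blin A -> rsa A ->
  l * rdot x x < rdot (A x) x ->
  exists2 m, l < m & forall S, blin S -> ~ forall x, S (A x - rscale m x) = x.
Proof.
move=> bA sA lx.
have x0 : x != 0 by apply: contraTneq lx => ->; rewrite (blin0 bA) !rdot0l mulr0 ltxx.
have [//|//|//|//|//|m [Am hm]] := @sup_quadratic_form _ A setT x bA sA.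
exists m => [|S bS AS].
  by rewrite -(ltr_pM2r (rdot_gt0 x0)) (lt_le_trans lx)// Am.
have [C C0 hC] := blin_bound bS.
apply: (hm (C ^+ 2)^-1) => [|z _]; first by rewrite invr_gt0 exprn_gt0.
rewrite mulrC ler_pdivrMr ?exprn_gt0// -opprB rdotNl rdotNr opprK !rdot_self -exprMn.
rewrite lerXn2r// ?nnegrE ?mulr_ge0 ?nrm_ge0 ?(ltW C0)//.
by rewrite mulrC -{1}(AS z) hC.
Qed.

(** The supremum of the quadratic form is in the spectrum, because A minus it is
not bounded below. *)
Lemma sup_spec_form U (A : {linear U -> U}) (l : R) : continuous A -> self_adjoint A ->
  (sup_spec A <= l%:E)%E -> forall x, rdot (A x) x <= l * rdot x x.
Proof.
move=> cA sA Al x; rewrite leNgt; apply/negP => /sup_form_not_regular.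
have bA : blin A by apply: continuous_blin => //; exact: linearP.
move=> /(_ bA (self_adjoint_rsa sA))[m lm hm].
move: lm; rewrite ltNge => /negP; apply; rewrite -lee_fin (le_trans _ Al)//.
apply: ereal_sup_ubound; exists m%:C => //= -[S [cS SA _]].
apply: (hm S) => //; apply: continuous_blin => //; exact: linearP.
Qed.

Lemma inf_spec_form U (A : {linear U -> U}) (l : R) : continuous A -> self_adjoint A ->
  (l%:E <= inf_spec A)%E -> forall x, l * rdot x x <= rdot (A x) x.
Proof.
move=> cA sA Al x; rewrite leNgt; apply/negP => lx.
have bA : blin A by apply: continuous_blin => //; exact: linearP.
have [|||m lm hm] := @sup_form_not_regular _ (fun x => - A x) (- l) x.
- exact: blin_opp.
- by move=> y z; rewrite rdotNl rdotNr (self_adjoint_rsa sA).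
- by rewrite rdotNl mulNr ltrN2.
move: lm; rewrite ltrNl ltNge => /negP; apply; rewrite -lee_fin (le_trans Al)//.
apply: ereal_inf_lbound; exists (- m)%:C => //= -[S [cS SA _]].
have bS : blin S by apply: continuous_blin => //; exact: linearP.
apply: (hm (fun x => - S x)); first exact: blin_opp.
move=> y; rewrite -(blinN bS) opprB opprK addrC -[RHS]SA.
by congr (S _); rewrite rmorphN scaleNr opprK addrC.
Qed.

(** Let m > 0 be the supremum of the form of J on the range K of P, and T the
operator m - P J P. On K, m e |z|^2 <= <B z, m z> <= <B z, T z>, so that T is
bounded below, which contradicts sup_quadratic_form. *)
Lemma lyapunov U (B J P : U -> U) (e : R) : blin B -> rsa B -> blin J -> rsa J ->
  oproj P -> (forall x, P (B x) = B (P x)) -> 0 < e ->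
  (forall z, P z = z -> e * rdot z z <= rdot (B z) z) ->
  (forall z, P z = z -> rdot (J (B z)) z <= 0) ->
  forall z, P z = z -> rdot (J z) z <= 0.
Proof.
move=> bB sB bJ sJ hP PB e0 Be JB z0 Pz0; rewrite leNgt; apply/negP => Jz0.
have bP := oproj_blin hP.
have z00 : z0 != 0 by apply: contraTneq Jz0 => ->; rewrite (blin0 bJ) rdot0l ltxx.
pose JP x := P (J (P x)).
have bJP : blin JP by apply: blin_comp => //; exact: blin_comp.
have sJP : rsa JP by move=> x y; rewrite /JP (oproj_rsa hP) sJ (oproj_rsa hP).
have [|||||m [Jm hm]] := @sup_quadratic_form _ JP [set z | P z = z] z0 bJP sJP.
- by move=> x y /= Px Py; rewrite blinD// Px Py.
- by move=> r x /= Px; rewrite blinR// Px.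
- by move=> x /= _; rewrite (oproj_idem hP).
- by [].
- by [].
have m0 : 0 < m.
  have := Jm z0 Pz0; rewrite /JP (oproj_rsa hP) Pz0 => h.
  by have := lt_le_trans Jz0 h; rewrite pmulr_lgt0 ?rdot_gt0.
have [C C0 hC] := blin_bound bB.
have me0 : 0 < m * e / C by rewrite divr_gt0 ?mulr_gt0.
apply: (hm ((m * e / C) ^+ 2)) => [|z /= Pz]; first by rewrite exprn_gt0.
set w := _ - _.
have z_ge0 := mulr_ge0 (ltW me0) (nrm_ge0 z).
suff h : m * e / C * nrm z <= nrm w by rewrite !rdot_self -exprMn lerXn2r// nnegrE nrm_ge0.
have [->|zz] := eqVneq (nrm z) 0; first by rewrite mulr0 nrm_ge0.
have zp : 0 < nrm z by rewrite lt_neqAle nrm_ge0 eq_sym zz.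
rewrite mulrAC ler_pdivrMr// -(ler_pM2r zp) -!mulrA -expr2 -rdot_self.
have h1 : m * rdot (B z) z <= rdot (B z) w.
  have := JB z Pz; rewrite sJ /w rdotBr rdotZr.
  have -> : rdot (B z) (JP z) = rdot (B z) (J z) by rewrite /JP Pz -(oproj_rsa hP) PB Pz.
  by rewrite lerBrDl gerDr.
apply: (@le_trans _ _ (m * rdot (B z) z)); first by rewrite ler_wpM2l ?(ltW m0)// Be.
rewrite (le_trans h1)// (le_trans (cauchy_schwarz _ _))//.
by rewrite mulrC ler_wpM2l ?nrm_ge0//.
Qed.

End QuadraticFormBounds.

(** * Block operators and graphs *)

Section DirectSumOperators.
Local Open Scope complex_scope.
Variables (R : realType) (H0 H1 : hilbertType R).
Local Notation H := (hsum H0 H1).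

Lemma hsum_rdot (z w : H) : rdot z w = rdot z.1 w.1 + rdot z.2 w.2.
Proof. by rewrite /rdot [inner z w]/(hsum_inner z w) /hsum_inner ReD. Qed.

Lemma hsum_eq (z w : H) : z.1 = w.1 -> z.2 = w.2 -> z = w.
Proof. by case: z w => a b [c d] /= -> ->. Qed.

Lemma blin_fst : blin (fun z : H => z.1).
Proof.
split=> // ; exists 1 => // z; rewrite mul1r; apply: ler_nrm.
by rewrite [leRHS]hsum_rdot lerDl rdot_ge0.
Qed.

Lemma blin_snd : blin (fun z : H => z.2).
Proof.
split=> // ; exists 1 => // z; rewrite mul1r; apply: ler_nrm.
by rewrite [leRHS]hsum_rdot lerDr rdot_ge0.
Qed.

Lemma blin_pair (U : hilbertType R) (f : U -> H0) (g : U -> H1) : blin f -> blin g ->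
  blin (fun x => (f x, g x) : H).
Proof.
move=> [lf [C C0 hC]] [lg [D D0 hD]]; split=> [a x y|]; first by rewrite lf lg.
exists (C + D) => [|x]; first exact: addr_ge0.
rewrite mulrDl (le_trans _ (lerD (hC x) (hD x)))//.
have h := hsum_norm_leD ((f x, g x) : H).
by move: h; rewrite !normE -rmorphD/= lecR.
Qed.

Lemma blin_block (A0 : H0 -> H0) (A1 : H1 -> H1) (V : H1 -> H0) :
  blin A0 -> blin A1 -> blin V -> blin (block_operator A0 A1 V).
Proof.
move=> b0 b1 bV; apply: blin_pair; apply: blin_add.
- exact: blin_comp b0 blin_fst.
- exact: blin_comp bV blin_snd.
- exact: blin_comp (blin_adjoint bV) blin_fst.
- exact: blin_comp b1 blin_snd.
Qed.

Lemma rsa_block (A0 : H0 -> H0) (A1 : H1 -> H1) (V : H1 -> H0) :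
  rsa A0 -> rsa A1 -> blin V -> rsa (block_operator A0 A1 V).
Proof.
move=> s0 s1 bV z w; rewrite !hsum_rdot /= !rdotDl !rdotDr s0 s1 (rdot_adjoint _ _ bV).
by rewrite (rdotC z.1 (V _)) (rdot_adjoint _ _ bV) (rdotC w.2); ring.
Qed.

Lemma graph0P (X : H0 -> H1) (z : H) : graph0 X z <-> z.2 = X z.1.
Proof. by split=> [[x _ <-]//|h]; exists z.1 => //; exact: hsum_eq. Qed.

Lemma graph_csubspace (X : H0 -> H1) : blin X -> csubspace (graph0 X : set H).
Proof.
move=> bX.
have -> : graph0 X = [set z : H | z.2 - X z.1 = 0].
  apply/seteqP; split=> z /=; first by move/graph0P => ->; rewrite subrr.
  by move/eqP; rewrite subr_eq0 => /eqP /graph0P.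
apply: ker_csubspace; apply: blin_sub; first exact: blin_snd.
exact: blin_comp bX blin_fst.
Qed.

(** The orthogonal complement of the graph of X is the graph of -X^*. *)
Lemma graph_projection (X : H0 -> H1) : blin X ->
  exists Q : H -> H, [/\ oproj Q, forall z, (Q z).2 = X (Q z).1,
    forall x, Q (x, X x) = (x, X x) & forall z, Q z = 0 <-> z.1 = - adjoint X z.2].
Proof.
move=> bX; have [Q [hQ GQ QG]] := projection_theorem (graph_csubspace bX).
have GQ' z : (Q z).2 = X (Q z).1 by apply/graph0P.
have QG' x : Q (x, X x) = (x, X x) by apply: QG; exists x.
exists Q; split=> // z; split=> [Qz|z1].
  apply/eqP; rewrite -addr_eq0; apply/eqP/rdot_eq => x; rewrite rdot0l.
  have := oproj_rsa hQ z (x, X x).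
  rewrite Qz rdot0l QG' hsum_rdot /= => ->.
  by rewrite rdotDl (rdotC (adjoint X _) x) -(rdot_adjoint _ _ bX) (rdotC (X x)).
apply: (oproj_quad_le0 hQ).
rewrite (oproj_rsa hQ) hsum_rdot GQ' z1 rdotNl (rdotC _ (Q z).1) -(rdot_adjoint _ _ bX).
by rewrite (rdotC z.2) addNr.
Qed.

End DirectSumOperators.

(** * Strict contractions *)

Section Contractions.
Variables (R : realType) (H0 H1 : hilbertType R) (X : H0 -> H1).
Hypothesis bX : blin X.
Hypothesis cX : forall x, nrm (X x) <= nrm x.

Lemma adjoint_quad x y : rdot (adjoint X (X x)) y = rdot (X x) (X y).
Proof. by rewrite rdotC -(rdot_adjoint _ _ bX) rdotC. Qed.

(** 1 - X^* X is positive, so |X x| = |x| only if X^* X x = x. *)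
Lemma not_isometric_strict : (forall x, adjoint X (X x) = x -> x = 0) ->
  forall x, x != 0 -> nrm (X x) < nrm x.
Proof.
move=> hX x; apply: contraNT; rewrite -leNgt => hx; apply/eqP/hX.
have bT : blin (fun x => x - adjoint X (X x)).
  by apply: blin_sub; [exact: blin_id|exact: blin_comp (blin_adjoint bX) bX].
have sT : rsa (fun x => x - adjoint X (X x)).
  by move=> y z; rewrite rdotBl rdotBr adjoint_quad (rdotC y (adjoint X _)) adjoint_quad (rdotC (X z)).
have pT y : 0 <= rdot (y - adjoint X (X y)) y.
  by rewrite rdotBl adjoint_quad subr_ge0 ler_rdot.
apply/esym/eqP; rewrite -subr_eq0; apply/eqP/(psd_eq0T bT sT pT).
apply/le_anti; rewrite pT andbT rdotBl adjoint_quad subr_le0.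
exact: ler_rdot.
Qed.

(** With v = X^* y, |v|^2 = <X v, y> <= |X v| |y| <= |X v| |v|. *)
Lemma adjoint_strict : (forall x, x != 0 -> nrm (X x) < nrm x) ->
  forall y, nrm y <= nrm (adjoint X y) -> y = 0.
Proof.
move=> hX y hy; set v := adjoint X y in hy *.
have h : nrm v * nrm v <= nrm (X v) * nrm v.
  rewrite -expr2 -rdot_self {2}/v -(rdot_adjoint _ _ bX) (le_trans (cauchy_schwarz _ _))//.
  by rewrite ler_wpM2l ?nrm_ge0.
have v0 : v = 0.
  apply/eqP/negPn/negP => v0; have := hX v v0; apply/negP; rewrite -leNgt.
  have vp : 0 < nrm v.
    by rewrite lt_neqAle nrm_ge0 andbT eq_sym; apply: contra v0 => /eqP/nrm_eq0->.
  by rewrite -(ler_pM2r vp).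
by apply: nrm_eq0; apply/le_anti; rewrite nrm_ge0 andbT (le_trans hy)// v0 nrm0.
Qed.

End Contractions.

(** * Graphs of strictly contractive solutions are spectral *)

Section Riccati.
Variables (R : realType) (H0 H1 : hilbertType R).
Variables (A0 : H0 -> H0) (A1 : H1 -> H1) (V : H1 -> H0) (lambda : R).
Hypothesis bA0 : blin A0.
Hypothesis bA1 : blin A1.
Hypothesis bV : blin V.
Hypothesis sA0 : rsa A0.
Hypothesis sA1 : rsa A1.
Hypothesis A0_le : forall x, rdot (A0 x) x <= lambda * rdot x x.
Hypothesis A1_ge : forall y, lambda * rdot y y <= rdot (A1 y) y.

Local Notation H := (hsum H0 H1).
Let B : H -> H := block_operator A0 A1 V.
Let bB : blin B. Proof. exact: blin_block. Qed.
Let sB : rsa B. Proof. exact: rsa_block. Qed.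

Definition riccati (Y : H0 -> H1) x :=
  A1 (Y x) - Y (A0 x) - Y (V (Y x)) + adjoint V x = 0.

Lemma A0_eq x : rdot (A0 x) x = lambda * rdot x x -> A0 x = rscale lambda x.
Proof.
move=> h; apply/esym/eqP; rewrite -subr_eq0; apply/eqP.
apply: (@psd_eq0T _ _ (fun x => rscale lambda x - A0 x)).
- by apply: blin_sub => //; apply: (blin_scale lambda (blin_id H0)).
- by move=> y z; rewrite rdotBl rdotBr sA0 rdotZl rdotZr.
- by move=> z; rewrite rdotBl rdotZl subr_ge0.
- by rewrite rdotBl rdotZl h subrr.
Qed.

Lemma A1_eq y : rdot (A1 y) y = lambda * rdot y y -> A1 y = rscale lambda y.
Proof.
move=> h; apply/eqP; rewrite -subr_eq0; apply/eqP.
apply: (@psd_eq0T _ _ (fun y => A1 y - rscale lambda y)).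
- exact: blin_shift.
- exact: rsa_shift.
- by move=> z; rewrite rdotBl rdotZl subr_ge0.
- by rewrite rdotBl rdotZl h subrr.
Qed.

Lemma rdot_adjoint_sym y x : rdot (adjoint V x) y = rdot (V y) x.
Proof. by rewrite (rdot_adjoint _ _ bV) rdotC. Qed.

(** Pairing the two rows of B z = lambda z with z.1 and z.2 shows that
Re <V z.2, z.1> is both >= 0 and <= 0; so z.1 and z.2 attain the bounds of
the forms of A0 and A1. *)
Lemma ker_block z : B z = rscale lambda z ->
  [/\ A0 z.1 = rscale lambda z.1, adjoint V z.1 = 0,
      A1 z.2 = rscale lambda z.2 & V z.2 = 0].
Proof.
move=> Bz.
have e1 : A0 z.1 + V z.2 = rscale lambda z.1 by exact: (congr1 fst Bz).
have e2 : adjoint V z.1 + A1 z.2 = rscale lambda z.2 by exact: (congr1 snd Bz).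
have h1 := congr1 (fun u => rdot u z.1) e1; rewrite /= rdotDl rdotZl in h1.
have h2 := congr1 (fun u => rdot u z.2) e2; rewrite /= rdotDl rdotZl rdot_adjoint_sym in h2.
have := A0_le z.1; have := A1_ge z.2 => g2 g1.
have a0 : A0 z.1 = rscale lambda z.1 by apply: A0_eq; lra.
have a1 : A1 z.2 = rscale lambda z.2 by apply: A1_eq; lra.
split => //.
  by move: e2; rewrite a1 => /eqP; rewrite -subr_eq0 addrK => /eqP.
by move: e1; rewrite a0 addrC => /eqP; rewrite -subr_eq0 addrK => /eqP.
Qed.

Let F := spectral_projection B.
Let hF : is_spectral_measure B F. Proof. exact: spectral_projectionP. Qed.

(** On the range of F(D) the operator s (lambda - B) is positive, and a positive
operator vanishes where its form does. *)
Lemma spectral_kernel D z (s : R) : s ^+ 2 = 1 -> measurable D -> F D z = z ->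
  (forall t, D t -> 0 <= s * (lambda - t)) ->
  s * (lambda * rdot z z - rdot (B z) z) = 0 -> B z = rscale lambda z.
Proof.
move=> s2 mD Fz pos eq0.
have bF := oproj_blin (spectral_oproj hF mD).
pose T z := rscale s (rscale lambda z - B z).
have bT : blin T.
  by apply: blin_scale; apply: blin_sub => //; apply: (blin_scale lambda (blin_id H)).
have sT : rsa T.
  by move=> x y; rewrite /T rdotZl rdotZr rdotBl rdotBr sB rdotZl rdotZr.
have q y : rdot (T y) y = s * (lambda * rdot y y - rdot (B y) y).
  by rewrite /T rdotZl rdotBl rdotZl.
have FT y : F D (T y) = T (F D y).
  by rewrite /T (blinR bF) (blinB bF) (blinR bF) (spectral_commB bB sB hF).
have Tz : T z = 0.
  apply: (@psd_eq0 _ _ T [set z | F D z = z] bT sT) => //=.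
  - by move=> y r Fy; rewrite (blinD bF) (blinR bF) FT Fy.
  - by move=> y Fy; rewrite FT Fy.
  - by move=> y Fy; rewrite q; exact: (spectral_bound hF mD Fy pos).
  - by rewrite q.
apply/esym/eqP; rewrite -subr_eq0; apply/eqP.
by rewrite -[LHS]rscale1 -s2 expr2 -rscaleA -/(T z) Tz /rscale scaler0.
Qed.

Let J (z : H) : H := (z.1, - z.2).
Let bJ : blin J.
Proof. by apply: blin_pair; [exact: blin_fst|apply: blin_opp; exact: blin_snd]. Qed.
Let sJ : rsa J.
Proof. by move=> z w; rewrite !hsum_rdot /= rdotNl rdotNr. Qed.

(** The terms with V cancel in the real part. *)
Lemma dissipative z : rdot (J (B z - rscale lambda z)) z <= 0.
Proof.
rewrite hsum_rdot /= rdotNl !rdotDl !rdotNl !rdotZl rdot_adjoint_sym.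
have := A0_le z.1; have := A1_ge z.2; lra.
Qed.

(** For D = {t | s (t - lambda) > e}, the operator s (B - lambda) is at least e on
the intersection of the ranges of Q and F(D), and sJ is positive there;
this contradicts lyapunov unless the intersection is 0. Let e tend to 0. *)
Lemma definite_side (Q : H -> H) (s : R) : s = 1 \/ s = -1 -> oproj Q ->
  (forall z, Q (B z) = B (Q z)) ->
  (forall z, Q z = z -> z != 0 -> 0 < s * rdot (J z) z) ->
  forall z, Q z = z -> 0 <= s * (lambda * rdot z z - rdot (B z) z).
Proof.
move=> s1 hQ QB Jpos z Qz.
have s2 : s * s = 1 by case: s1 => ->; rewrite ?mulN1r ?opprK ?mul1r.
suff main e : 0 < e -> 0 <= s * (lambda * rdot z z - rdot (B z) z) + e * rdot z z.
  have := rdot_ge0 z; set n := rdot z z in main *; set q := rdot (B z) z in main *.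
  move=> n0; rewrite leNgt; apply/negP => neg.
  set d := s * _ in main neg.
  have n1 : 0 < n + 1 by rewrite ltr_wpDl.
  (* With d < 0 this e leaves the negative number d / (n + 1). *)
  have := main (- d / (n + 1)); rewrite divr_gt0 ?oppr_gt0// => /(_ isT).
  have -> : d + - d / (n + 1) * n = d / (n + 1) by field; rewrite gt_eqF.
  by rewrite leNgt ltr_pdivrMr// mul0r neg.
move=> e0.
pose D : set R := [set t | e < s * (t - lambda)].
have mD : measurable D.
  case: s1 => sE; rewrite /D sE.
    have -> : [set t | e < 1 * (t - lambda)] = `]lambda + e, +oo[%classic :> set R.
      by apply/seteqP; split=> t /=; rewrite in_itv/= andbT mul1r ltrBrDr addrC.
    exact: measurable_itv.
  have -> : [set t | e < -1 * (t - lambda)] = `]-oo, lambda - e[%classic :> set R.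
    by apply/seteqP; split=> t /=; rewrite in_itv/= mulN1r opprB ltrBrDr [X in X < _]addrC -ltrBrDr.
  exact: measurable_itv.
have hD := spectral_oproj hF mD.
have FQ y : F D (Q y) = Q (F D y) by exact: (spectral_commute bB sB hF).
pose P y := Q (F D y).
have hP : oproj P by apply: oproj_comp => // y; rewrite FQ.
have PE y : P y = y -> Q y = y /\ F D y = y.
  by move=> Py; split; rewrite -Py /P; [exact: oproj_idem|rewrite FQ (oproj_idem hD)].
have FB y : F D (B y) = B (F D y) by exact: (spectral_commB bB sB hF).
pose B' y := rscale s (B y - rscale lambda y).
have bB' : blin B' by apply: blin_scale; exact: blin_shift.
have sB' : rsa B' by move=> x y; rewrite rdotZl rdotZr (rsa_shift lambda sB).
pose J' y := rscale s (J y).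
have bJ' : blin J' by exact: blin_scale.
have sJ' : rsa J' by move=> x y; rewrite rdotZl rdotZr sJ.
have bP := oproj_blin hP.
have PB' y : P (B' y) = B' (P y).
  by rewrite /B' (blinR bP) (blinB bP) (blinR bP) /P FB QB.
have B'e y : P y = y -> e * rdot y y <= rdot (B' y) y.
  case/PE => _ Fy.
  have := spectral_bound hF (s := - s) (a := lambda + s * e) mD Fy.
  rewrite /B' rdotZl rdotBl rdotZl.
  have -> : - s * ((lambda + s * e) * rdot y y - rdot (B y) y) =
     s * (rdot (B y) y - lambda * rdot y y) - (s * s) * e * rdot y y by ring.
  rewrite s2 mul1r subr_ge0; apply => t; rewrite /D /= => h.
  have -> : - s * (lambda + s * e - t) = s * (t - lambda) - (s * s) * e by ring.
  by rewrite s2 mul1r subr_ge0 ltW.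
have J'B' y : P y = y -> rdot (J' (B' y)) y <= 0.
  move=> _; rewrite /J' /B' (blinR bJ) !rdotZl mulrA s2 mul1r.
  exact: dissipative.
(* The form of J' is <= 0 on the range of P by lyapunov, and > 0 off 0. *)
have P0 y : P y = y -> y = 0.
  move=> Py; apply/eqP/negPn/negP => y0.
  have [Qy _] := PE y Py.
  have := lyapunov bB' sB' bJ' sJ' hP PB' e0 B'e J'B' Py.
  by rewrite /J' rdotZl leNgt Jpos.
have Fz : F D z = 0.
  by rewrite -[in LHS]Qz FQ; apply: P0; rewrite /P FQ !(oproj_idem hD) (oproj_idem hQ).
have FCz : F (~` D) z = z by rewrite (spectralC hF)// Fz subr0.
have := spectral_bound hF (s := s) (a := lambda + s * e) (measurableC mD) FCz.
have -> : s * ((lambda + s * e) * rdot z z - rdot (B z) z) =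
   s * (lambda * rdot z z - rdot (B z) z) + (s * s) * e * rdot z z by ring.
rewrite s2 mul1r; apply => t; rewrite /D /= => /negP; rewrite -leNgt => h.
have -> : s * (lambda + s * e - t) = (s * s) * e - s * (t - lambda) by ring.
by rewrite s2 mul1r subr_ge0.
Qed.

Section Solution.
Variable X : H0 -> H1.
Hypothesis bX : blin X.
Hypothesis ricX : forall x, riccati X x.

Lemma riccati_graph x : B (x, X x) = (A0 x + V (X x), X (A0 x + V (X x))).
Proof.
apply: hsum_eq => //=; rewrite (blinD bX); apply/eqP; rewrite -subr_eq0 -(ricX x).
by rewrite opprD addrC addrA [_ + A1 _]addrC; apply/eqP; rewrite -!addrA; congr (_ + _); rewrite addrC -addrA addrC -!addrA; congr (_ + _); rewrite addrC.
Qed.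

Lemma graph_commute (Q : H -> H) : oproj Q -> (forall z, (Q z).2 = X (Q z).1) ->
  (forall x, Q (x, X x) = (x, X x)) -> forall z, Q (B z) = B (Q z).
Proof.
move=> hQ GQ QG; apply: oproj_commute => // z.
have -> : Q z = ((Q z).1, X (Q z).1) by apply: hsum_eq => //=; exact: GQ.
by rewrite riccati_graph QG.
Qed.

End Solution.

Section StrictSolution.
Variable X : H0 -> H1.
Hypothesis bX : blin X.
Hypothesis ricX : forall x, riccati X x.
Hypothesis strictX : forall x, x != 0 -> nrm (X x) < nrm x.
Variable Q : H -> H.
Hypothesis hQ : oproj Q.
Hypothesis GQ : forall z, (Q z).2 = X (Q z).1.
Hypothesis QG : forall x, Q (x, X x) = (x, X x).
Hypothesis kerQ : forall z, Q z = 0 <-> z.1 = - adjoint X z.2.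

Let QB z : Q (B z) = B (Q z). Proof. exact: (graph_commute bX ricX hQ GQ QG). Qed.
Let bQ := oproj_blin hQ.

Lemma graph_below z : Q z = z -> rdot (B z) z <= lambda * rdot z z.
Proof.
move=> Qz; rewrite -subr_ge0 -[leRHS]mul1r.
apply: (definite_side (or_introl erefl) hQ QB) Qz => {}z Qz z0.
rewrite mul1r hsum_rdot /= rdotNl subr_gt0 -[in X in X < _]Qz GQ Qz !rdot_self.
rewrite ltrXn2r// ?nnegrE ?nrm_ge0//; apply: strictX.
apply: contra z0 => /eqP z1; apply/eqP/hsum_eq => //.
by rewrite -Qz GQ Qz z1 (blin0 bX).
Qed.

Lemma graph_above z : Q z = 0 -> lambda * rdot z z <= rdot (B z) z.
Proof.
move=> Qz; rewrite -subr_ge0 -opprB -mulN1r.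
have hQ' := oproj_compl hQ.
apply: (definite_side (or_intror erefl) hQ') => [y|{Qz}y Qy y0|]; last by rewrite Qz subr0.
  by rewrite (blinB bB) QB.
have {}Qy : Q y = 0 by rewrite -Qy (blinB bQ) (oproj_idem hQ) subrr.
have /kerQ y1 := Qy.
rewrite mulN1r hsum_rdot /= rdotNl opprB subr_gt0 !rdot_self.
rewrite ltrXn2r// ?nnegrE ?nrm_ge0// y1 nrmN ltNge; apply/negP => h.
move/eqP: y0; apply; apply: hsum_eq; first by rewrite y1 (adjoint_strict bX strictX h) (blin0 (blin_adjoint bX)) oppr0.
exact: (adjoint_strict bX strictX h).
Qed.

(** The range of Q meets that of F(]lambda, +oo[) in 0, by graph_below. Where the
kernel of Q meets the range of F(]-oo, lambda]), B = lambda by graph_above; this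
part is in Ker (B - lambda) = K0, and the graph of -X^* meets H0 in 0. *)
Lemma graph_spectral_le : (forall y, A1 y = rscale lambda y -> V y = 0 -> y = 0) ->
  forall z, Q z = F `]-oo, lambda]%classic z.
Proof.
move=> K1 z.
have mD : measurable (`]-oo, lambda]%classic : set R) by exact: measurable_itv.
have hD := spectral_oproj hF mD; have bD := oproj_blin hD.
have FQ y : F `]-oo, lambda]%classic (Q y) = Q (F `]-oo, lambda]%classic y).
  exact: (spectral_commute bB sB hF).
have mC := measurableC mD; have hC := spectral_oproj hF mC.
have h1 y : Q y = y -> F `]-oo, lambda]%classic y = y.
  move=> Qy; apply/esym/eqP; rewrite -subr_eq0 -(spectralC hF)//; apply/eqP.
  set w := F _ y.
  have Fw : F (~` `]-oo, lambda]%classic) w = w by exact: oproj_idem.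
  have Qw : Q w = w by rewrite /w (spectralC hF)// (blinB bQ) -FQ Qy.
  have pos t : (~` `]-oo, lambda]%classic) t -> 0 < -1 * (lambda - t).
    by rewrite /= in_itv/= mulN1r opprB subr_gt0 => /negP; rewrite -ltNge.
  apply: (spectral_strict hF mC Fw pos); apply/le_anti.
  rewrite (spectral_bound hF mC Fw) => [|t /pos/ltW//].
  by rewrite mulN1r oppr_le0 subr_ge0 graph_below.
have h2 y : Q y = 0 -> F `]-oo, lambda]%classic y = 0.
  move=> Qy; set w := F _ y.
  have Fw : F `]-oo, lambda]%classic w = w by exact: oproj_idem.
  have Qw : Q w = 0 by rewrite /w -FQ Qy (blin0 bD).
  have pos t : `]-oo, lambda]%classic t -> 0 <= 1 * (lambda - t).
    by rewrite /= in_itv/= mul1r subr_ge0.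
  have /ker_block[_ _ a1 v1] : B w = rscale lambda w.
    apply: (spectral_kernel (expr1n _ _) mD Fw pos); apply/le_anti.
    rewrite (spectral_bound hF mD Fw pos) andbT mul1r subr_le0.
    exact: graph_above.
  have w2 : w.2 = 0 by exact: K1.
  have /kerQ w1 := Qw.
  by apply: hsum_eq => //; rewrite w1 w2 (blin0 (blin_adjoint bX)) oppr0.
rewrite -[z in RHS](subrK (Q z)) (blinD bD) (h1 (Q z)) ?(oproj_idem hQ)// (h2 (z - Q z)) ?add0r//.
by rewrite (blinB bQ) (oproj_idem hQ) subrr.
Qed.

(** The kernel of Q meets the range of F(]-oo, lambda[) in 0, by graph_above.
Where the range of Q meets that of F([lambda, +oo[), B = lambda by graph_below; this
part is in Ker (B - lambda) = K1, and the graph of X meets H1 in 0. *)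
Lemma graph_spectral_lt : (forall x, A0 x = rscale lambda x -> adjoint V x = 0 -> x = 0) ->
  forall z, Q z = F `]-oo, lambda[%classic z.
Proof.
move=> K0 z.
have mD : measurable (`]-oo, lambda[%classic : set R) by exact: measurable_itv.
have hD := spectral_oproj hF mD; have bD := oproj_blin hD.
have FQ y : F `]-oo, lambda[%classic (Q y) = Q (F `]-oo, lambda[%classic y).
  exact: (spectral_commute bB sB hF).
have mC := measurableC mD; have hC := spectral_oproj hF mC.
have h1 y : Q y = y -> F `]-oo, lambda[%classic y = y.
  move=> Qy; apply/esym/eqP; rewrite -subr_eq0 -(spectralC hF)//; apply/eqP.
  set w := F _ y.
  have Fw : F (~` `]-oo, lambda[%classic) w = w by exact: oproj_idem.
  have Qw : Q w = w by rewrite /w (spectralC hF)// (blinB bQ) -FQ Qy.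
  have pos t : (~` `]-oo, lambda[%classic) t -> 0 <= -1 * (lambda - t).
    by rewrite /= in_itv/= mulN1r opprB subr_ge0 => /negP; rewrite -leNgt.
  have /ker_block[a0 v0 _ _] : B w = rscale lambda w.
    apply: (spectral_kernel _ mC Fw pos); first by rewrite sqrrN expr1n.
    apply/le_anti; rewrite (spectral_bound hF mC Fw pos) andbT.
    by rewrite mulN1r oppr_le0 subr_ge0 graph_below.
  have w1 : w.1 = 0 by exact: K0.
  by apply: hsum_eq => //; rewrite -Qw GQ Qw w1 (blin0 bX).
have h2 y : Q y = 0 -> F `]-oo, lambda[%classic y = 0.
  move=> Qy; set w := F _ y.
  have Fw : F `]-oo, lambda[%classic w = w by exact: oproj_idem.
  have Qw : Q w = 0 by rewrite /w -FQ Qy (blin0 bD).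
  have pos t : `]-oo, lambda[%classic t -> 0 < 1 * (lambda - t).
    by rewrite /= in_itv/= mul1r subr_gt0.
  apply: (spectral_strict hF mD Fw pos); apply/le_anti.
  rewrite (spectral_bound hF mD Fw) => [|t /pos/ltW//].
  by rewrite andbT mul1r subr_le0 graph_above.
rewrite -[z in RHS](subrK (Q z)) (blinD bD) (h1 (Q z)) ?(oproj_idem hQ)// (h2 (z - Q z)) ?add0r//.
by rewrite (blinB bQ) (oproj_idem hQ) subrr.
Qed.

End StrictSolution.

End Riccati.

(** * Consequences of uniqueness *)

Section Uniqueness.
Local Open Scope complex_scope.
Variables (R : realType) (H0 H1 : hilbertType R).
Variables (A0 : H0 -> H0) (A1 : H1 -> H1) (V : H1 -> H0) (lambda : R).
Hypothesis bA0 : blin A0.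
Hypothesis bA1 : blin A1.
Hypothesis bV : blin V.
Hypothesis sA0 : rsa A0.
Hypothesis sA1 : rsa A1.
Hypothesis A0_le : forall x, rdot (A0 x) x <= lambda * rdot x x.
Hypothesis A1_ge : forall y, lambda * rdot y y <= rdot (A1 y) y.
Variable X : H0 -> H1.
Hypothesis bX : blin X.
Hypothesis cX : forall x, nrm (X x) <= nrm x.
Hypothesis ricX : forall x, riccati A0 A1 V X x.
Hypothesis uniqueX : forall Y, blin Y -> (forall x, nrm (Y x) <= nrm x) ->
  (forall x, riccati A0 A1 V Y x) -> forall x, Y x = X x.

Let A0E := A0_eq bA0 sA0 A0_le.
Let A1E := A1_eq bA1 sA1 A1_ge.
Let bV' := blin_adjoint bV.
Let bX' := blin_adjoint bX.

(** Pair the Riccati equation with y and move all operators to the side of y. *)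
Lemma dual_riccati y : adjoint X (A1 y) - A0 (adjoint X y) -
  adjoint X (adjoint V (adjoint X y)) + V y = 0.
Proof.
apply: rdot_eq => x; rewrite rdot0l.
have h := congr1 (fun u => rdot u y) (ricX x).
rewrite /= !rdotE sA1 !(rdot_adjoint _ _ bX) (rdot_adjoint_sym bV) sA0 (rdot_adjoint _ _ bV) in h.
rewrite (rdot_adjoint _ _ bX) in h.
by rewrite !rdotE ![rdot _ x]rdotC (rdotC x (V y)) -h; ring.
Qed.

(** Pairing the Riccati equation with X n for X^* X n = n yields
<A1 X n, X n> = <A0 n, n>; as A0 <= lambda <= A1 both equal lambda |n|^2.
What remains of the Riccati equation and of its dual are the last two
identities. *)
Lemma isometric_vector_eigen n : adjoint X (X n) = n ->
  [/\ A0 n = rscale lambda n, A1 (X n) = rscale lambda (X n),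
      adjoint V n = X (V (X n)) & adjoint X (X (V (X n))) = V (X n)].
Proof.
move=> XXn.
have q y : rdot (X y) (X n) = rdot y n by rewrite (rdot_adjoint _ _ bX) XXn.
have h := congr1 (fun u => rdot u (X n)) (ricX n).
rewrite /= !rdotE !q (rdot_adjoint_sym bV) in h.
have h0 := A0_le n; have h1 := A1_ge (X n); rewrite q in h1.
have a0 : A0 n = rscale lambda n by apply: A0E; lra.
have a1 : A1 (X n) = rscale lambda (X n) by apply: A1E; rewrite q; lra.
have v : adjoint V n = X (V (X n)).
  have := ricX n; rewrite /riccati a0 a1 (blinR bX) subrr sub0r addrC => /eqP.
  by rewrite subr_eq0 => /eqP.
split => //.
have := dual_riccati (X n); rewrite a1 (blinR bX') XXn a0 subrr sub0r v addrC => /eqP.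
by rewrite subr_eq0 => /eqP.
Qed.

(** Let P be the projection onto N = Ker (1 - X^* X). The operator
Y = X (1 - 2 P) is a contraction, and it solves the Riccati equation because
N and its complement are invariant under A0 and V X. So Y = X, hence X P = 0,
while X is isometric on N. *)
Lemma unique_not_isometric n : adjoint X (X n) = n -> n = 0.
Proof.
have bN : blin (fun x => x - adjoint X (X x)).
  by apply: blin_sub; [exact: blin_id|exact: blin_comp bX' bX].
have [P [hP KP PK]] := projection_theorem (ker_csubspace bN).
have bP := oproj_blin hP; have sP := oproj_rsa hP.
have XXP x : adjoint X (X (P x)) = P x.
  by have /eqP := KP x; rewrite subr_eq0 => /eqP.
have PXX x : adjoint X (X x) = x -> P x = x by move=> h; apply: PK; rewrite /= h subrr.
(* 1 - 2 P is unitary. *)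
pose Y x := X (x - rscale 2 (P x)).
have bY : blin Y.
  by apply: blin_comp => //; apply: blin_sub; [exact: blin_id|exact: blin_scale].
have cY x : nrm (Y x) <= nrm x.
  rewrite (le_trans (cX _))//; apply: ler_nrm.
  by rewrite !rdotE (rdotC x) (oproj_quad _ hP); lra.
have YP x : P x = x -> Y x = - X x.
  by move=> Px; rewrite /Y Px -(blinN bX); congr X; rewrite /rscale rmorph_nat scaler_nat mulr2n opprD addrA subrr sub0r.
have YK x : P x = 0 -> Y x = X x.
  by move=> Px; rewrite /Y Px /rscale scaler0 subr0.
have ricY x : riccati A0 A1 V Y x.
  set m := P x; set u := x - m.
  have xE : x = u + m by rewrite subrK.
  have Pm : P m = m by exact: oproj_idem.
  have Pu : P u = 0 by rewrite (blinB bP) Pm subrr.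
  (* The equation is checked on m in N and on u orthogonal to N. *)
  have [a0 a1 v xv] := isometric_vector_eigen (XXP x : adjoint X (X m) = m).
  have PVm : P (V (X m)) = V (X m) by exact: PXX.
  have PAu : P (A0 u) = 0.
    apply: rdot_eq => w; rewrite rdot0l sP sA0.
    have [-> _ _ _] := isometric_vector_eigen (XXP w).
    by rewrite rdotZr -sP Pu rdot0l mulr0.
  have PVu : P (V (X u)) = 0.
    apply: rdot_eq => w; rewrite rdot0l sP (rdot_adjoint _ _ bV).
    have [_ _ -> h] := isometric_vector_eigen (XXP w).
    by rewrite (rdot_adjoint _ _ bX) h -(PXX _ h) -sP Pu rdot0l.
  rewrite /riccati xE (blinD bY) (YK u Pu) (YP m Pm).
  rewrite (blinD bA0) (blinD bA1) (blinD bV) (blinD bV') !(blinD bY).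
  rewrite (blinN bA1) (blinN bV) (blinN bY) a0 a1 (blinR bY) (YP m Pm) (YP _ PVm).
  rewrite (YK _ PAu) (YK _ PVu) v opprK.
  have := ricX u; rewrite /riccati.
  have -> : rscale lambda (- X m) = - rscale lambda (X m) by rewrite /rscale scalerN.
  move: (A1 (X u)) (rscale lambda (X m)) (X (A0 u)) (X (V (X u))) (X (V (X m))) (adjoint V u).
  move=> a b c d e f h.
  by rewrite -[RHS]h; apply: rdot_eq => w; rewrite !rdotE; ring.
move=> XXn; have Pn := PXX n XXn.
have := uniqueX bY cY ricY n; rewrite (YP n Pn) => h.
have Xn : X n = 0.
  apply/rdot_eq => w; have := congr1 (fun u => rdot u w) h; rewrite /= rdotNl rdot0l; lra.
by rewrite -XXn Xn (blin0 bX').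
Qed.

(** X (1 - P0) is a contractive solution: A0 commutes with P0, and P0 V = 0 and
V^* P0 = 0. *)
Lemma unique_vanishes_K0 k : A0 k = rscale lambda k -> adjoint V k = 0 -> X k = 0.
Proof.
move=> Ak Vk.
have bN : blin (fun x => (A0 x - rscale lambda x, adjoint V x) : hsum H0 H1).
  by apply: blin_pair => //; exact: blin_shift.
have [P [hP KP PK]] := projection_theorem (ker_csubspace bN).
have bP := oproj_blin hP; have sP := oproj_rsa hP.
have AP x : A0 (P x) = rscale lambda (P x).
  by have /(congr1 fst)/eqP := KP x; rewrite subr_eq0 => /eqP.
have VP x : adjoint V (P x) = 0 by have /(congr1 snd) := KP x.
have PA x : P (A0 x) = A0 (P x).
  by apply: (@oproj_commute _ _ P A0 hP sA0) => z; rewrite AP (blinR bP) (oproj_idem hP).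
have PV y : P (V y) = 0.
  by apply: rdot_eq => w; rewrite sP (rdot_adjoint _ _ bV) VP rdot0r rdot0l.
pose Y x := X (x - P x).
have bY : blin Y.
  by apply: blin_comp => //; apply: blin_sub => //; exact: blin_id.
have cY x : nrm (Y x) <= nrm x.
  by rewrite (le_trans (cX _))//; exact: (oproj_le x (oproj_compl hP)).
have ricY x : riccati A0 A1 V Y x.
  rewrite /riccati /Y PA PV subr0 -(blinB bA0) -[RHS](ricX (x - P x)).
  by rewrite (blinB bV') VP subr0.
have Pk : P k = k by apply: PK; rewrite /= Ak subrr Vk.
by rewrite -(uniqueX bY cY ricY k) /Y Pk subrr (blin0 bX).
Qed.

(** (1 - P1) X is a contractive solution: A1 commutes with P1, and V P1 = 0 and
P1 V^* = 0. *)
Lemma unique_orthogonal_K1 k x : A1 k = rscale lambda k -> V k = 0 -> rdot (X x) k = 0.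
Proof.
move=> Ak Vk.
have bN : blin (fun y => (V y, A1 y - rscale lambda y) : hsum H0 H1).
  by apply: blin_pair => //; exact: blin_shift.
have [P [hP KP PK]] := projection_theorem (ker_csubspace bN).
have bP := oproj_blin hP; have sP := oproj_rsa hP.
have AP y : A1 (P y) = rscale lambda (P y).
  by have /(congr1 snd)/eqP := KP y; rewrite subr_eq0 => /eqP.
have VP y : V (P y) = 0 by have /(congr1 fst) := KP y.
have PA y : P (A1 y) = A1 (P y).
  by apply: (@oproj_commute _ _ P A1 hP sA1) => z; rewrite AP (blinR bP) (oproj_idem hP).
have PV z : P (adjoint V z) = 0.
  by apply: rdot_eq => w; rewrite sP (rdot_adjoint_sym bV) VP rdot0l rdot0l.
pose Y z := X z - P (X z).
have bY : blin Y by apply: blin_sub => //; exact: blin_comp.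
have cY z : nrm (Y z) <= nrm z.
  by rewrite (le_trans _ (cX _))//; exact: (oproj_le (X z) (oproj_compl hP)).
have ricY z : riccati A0 A1 V Y z.
  rewrite /riccati /Y (blinB bA1) (blinB bV) VP subr0 -PA.
  have /(congr1 P) := ricX z; rewrite (blin0 bP) !(blinD bP, blinN bP) PV addr0 => Ph.
  have h := ricX z; rewrite /riccati in h.
  rewrite -[RHS]subr0 -{1}h -Ph.
  move: (A1 (X z)) (P (A1 (X z))) (X (A0 z)) (P (X (A0 z))) (X (V (X z))) (P (X (V (X z)))) (adjoint V z).
  move=> a a' b b' c c' d.
  by apply: rdot_eq => w; rewrite !rdotE; ring.
have Pk : P k = k by apply: PK; rewrite /= Ak subrr Vk.
have := uniqueX bY cY ricY x; rewrite -Pk -sP /Y => h.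
have -> : P (X x) = 0 by apply: oppr_inj; apply: (addrI (X x)); rewrite h oppr0 addr0.
by rewrite rdot0l.
Qed.

(** For unit vectors e0 in K0 and e1 in K1, the operator X + <., e0> e1 is a
solution, as A0 e0 = lambda e0, A1 e1 = lambda e1 and V^* e0 = 0, V e1 = 0.
It is a contraction since X e0 = 0 and X has its range orthogonal to e1. *)
Lemma unique_dichotomy :
  (forall k, A0 k = rscale lambda k -> adjoint V k = 0 -> k = 0) \/
  (forall k, A1 k = rscale lambda k -> V k = 0 -> k = 0).
Proof.
have [|/existsNP[k0]] := pselect (forall k, A0 k = rscale lambda k -> adjoint V k = 0 -> k = 0).
  by left.
move=> /not_implyP[Ak0 /not_implyP[Vk0 /eqP k00]]; right => k Ak Vk.
apply/eqP/negPn/negP => kN0.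
pose e0 := rscale (nrm k0)^-1 k0; pose e1 := rscale (nrm k)^-1 k.
have n0 : nrm k0 != 0 by apply: contra k00 => /eqP/nrm_eq0->.
have n1 : nrm k != 0 by apply: contra kN0 => /eqP/nrm_eq0->.
have i0 : inner e0 e0 = 1.
  by rewrite inner_self /e0 nrmZ ger0_norm ?invr_ge0 ?nrm_ge0// mulVf// expr1n.
have i1 : inner e1 e1 = 1.
  by rewrite inner_self /e1 nrmZ ger0_norm ?invr_ge0 ?nrm_ge0// mulVf// expr1n.
have A0e : A0 e0 = lambda%:C *: e0 by rewrite (blinR bA0) Ak0 /rscale !scalerA mulrC.
have A1e : A1 e1 = lambda%:C *: e1 by rewrite (blinR bA1) Ak /rscale !scalerA mulrC.
have V0e : adjoint V e0 = 0 by rewrite (blinR bV') Vk0 /rscale scaler0.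
have V1e : V e1 = 0 by rewrite (blinR bV) Vk /rscale scaler0.
have Xe0 : X e0 = 0 by rewrite (blinR bX) (unique_vanishes_K0 Ak0 Vk0) /rscale scaler0.
move: i0 i1 A0e A1e V0e V1e Xe0; move: e0 e1 => e0 e1 i0 i1 A0e A1e V0e V1e Xe0.
(* The modified solution must be complex linear, so the coefficient is complex. *)
pose c x := inner x e0.
pose Y x := X x + c x *: e1.
have orth x : rdot (X x) (c x *: e1) = 0.
  apply: unique_orthogonal_K1.
    by rewrite (blinZ bA1) A1e /rscale !scalerA mulrC.
  by rewrite (blinZ bV) V1e scaler0.
have cc (U : hilbertType R) (e : U) x : inner e e = 1 -> rdot (c x *: e) (c x *: e) = complex.Re (c x * conjc (c x)).
  by move=> ee; rewrite /rdot innerZl innerZr ee mulr1.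
have lY : linear Y.
  move=> a x y; rewrite /Y /c (blinD bX) (blinZ bX) innerDl innerZl scalerDl scalerDr.
  by rewrite scalerA addrACA.
have cY x : nrm (Y x) <= nrm x.
  have Yq : rdot (Y x) (Y x) = rdot (X x) (X x) + complex.Re (c x * conjc (c x)).
    by rewrite /Y rdotDl !rdotDr orth (rdotC (_ *: _)) orth cc// addr0 add0r.
  have uq : rdot (x - c x *: e0) (x - c x *: e0) = rdot x x - complex.Re (c x * conjc (c x)).
    have xc : rdot x (c x *: e0) = complex.Re (c x * conjc (c x)).
      by rewrite /rdot innerZr mulrC.
    by rewrite rdotBl !rdotBr (rdotC (_ *: _)) xc cc//; ring.
  have Xu : X (x - c x *: e0) = X x by rewrite (blinB bX) (blinZ bX) Xe0 scaler0 subr0.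
  apply: ler_nrm; rewrite Yq -lerBrDr -uq -Xu; exact: ler_rdot.
have bY : blin Y by split => //; exists 1 => // x; rewrite mul1r.
have cA x : c (A0 x) = lambda%:C * c x.
  have hA : self_adjoint A0 by apply: rsa_self_adjoint => //; case: bA0.
  by rewrite /c hA A0e innerZr conjc_real.
have cV y : c (V y) = 0 by rewrite /c (inner_adjoint _ _ bV) V0e inner_conj inner0l conjc0.
have ricY x : riccati A0 A1 V Y x.
  rewrite /riccati /Y (blinD bA1) (blinZ bA1) A1e (blinD bV) (blinZ bV) V1e scaler0 addr0.
  rewrite cA cV scale0r addr0 !scalerA (mulrC _ (c x)) -[RHS](ricX x).
  by rewrite opprD addrACA subrr addr0.
have := uniqueX bY cY ricY e0; rewrite /Y /c i0 Xe0 scale1r add0r => e10.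
move/eqP: i1; rewrite e10 inner0l eq_sym oner_eq0//.
Qed.

End Uniqueness.

(** * Uniqueness of a solution with a spectral graph *)

Section SpectralGraph.
Variables (R : realType) (H0 H1 : hilbertType R).
Variables (A0 : H0 -> H0) (A1 : H1 -> H1) (V : H1 -> H0).
Hypothesis bA0 : blin A0.
Hypothesis bA1 : blin A1.
Hypothesis bV : blin V.
Hypothesis sA0 : rsa A0.
Hypothesis sA1 : rsa A1.
Local Notation B := (block_operator A0 A1 V).

(** Let w be the component orthogonal to the graph of X of a vector in the graph
of Y. It is in the graph of Y, because the spectral projection commutes with
the projection onto that graph, and in the graph of -X^*; the norms of the two
components of w show that w = 0. *)
Lemma spectral_graph_unique (X Y : H0 -> H1) : blin X -> blin Y ->
  (forall x, x != 0 -> nrm (X x) < nrm x) -> (forall x, nrm (Y x) <= nrm x) ->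
  spectral_subspace B (graph0 X) -> (forall x, riccati A0 A1 V Y x) ->
  forall x, Y x = X x.
Proof.
move=> bX bY strictX cY [D mD GD] ricY x.
have bB := blin_block bA0 bA1 bV; have sB := rsa_block sA0 sA1 bV.
have hF := spectral_projectionP bB sB.
set F := spectral_projection B in hF GD.
have hD := spectral_oproj hF mD.
have [Q [hQ GQ QG kerQ]] := graph_projection bX.
have [P [hP GP PG _]] := graph_projection bY.
have bP := oproj_blin hP.
have PB := graph_commute bV sA0 sA1 bY ricY hP GP PG.
have FP z : F D (P z) = P (F D z) by exact: (spectral_commute bB sB hF).
pose z : hsum H0 H1 := (x, Y x).
pose w := z - F D z.
have Pw : P w = w by rewrite /w (blinB bP) -FP PG.
have Qw : Q w = 0.
  have FQ y : F D (Q y) = Q y.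
    have : graph0 X (Q y) by apply/graph0P.
    by rewrite GD => -[v _ <-]; exact: oproj_idem.
  apply: (oproj_quad_le0 hQ).
  rewrite (oproj_rsa hQ) -FQ -(oproj_rsa hD) /w (blinB (oproj_blin hD)) (oproj_idem hD).
  by rewrite subrr rdot0l.
have /kerQ w1 := Qw.
have w2 : w.2 = 0.
  apply: (adjoint_strict bX strictX).
  by rewrite -(nrmN (adjoint X _)) -w1 -[X in nrm X.2]Pw GP Pw cY.
have w0 : w = 0 by apply: hsum_eq => //; rewrite w1 w2 (blin0 (blin_adjoint bX)) oppr0.
have zD : z = F D z by apply/eqP; rewrite -subr_eq0; apply/eqP.
have : graph0 X z by rewrite GD zD; exists z.
by move/graph0P.
Qed.

End SpectralGraph.

Theorem theorem4p3 (R : realType) (H0 H1 : hilbertType R)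
    (sepH : separable_space (hsum H0 H1))
    (A0 : {linear H0 -> H0}) (A1 : {linear H1 -> H1}) (V : {linear H1 -> H0})
    (A0_bounded : continuous A0) (A1_bounded : continuous A1)
    (V_bounded : continuous V)
    (A0_self_adjoint : self_adjoint A0) (A1_self_adjoint : self_adjoint A1)
    (lambda : R)
    (le_lambda : (sup_spec A0 <= lambda%:E)%E)
    (lambda_le : (lambda%:E <= inf_spec A1)%E)
    (X : {linear H0 -> H1}) (X_sol : contractive_solution A0 A1 V X) :
  let B := block_operator A0 A1 V in
  (unique_contractive_solution A0 A1 V X <->
     spectral_subspace B (graph0 X) /\ ~ is_eigenvalue (opabs X) 1) /\
  (unique_contractive_solution A0 A1 V X ->
     strict_contraction X /\
     (range (spectral_projection B `]-oo, lambda[%classic) = graph0 X \/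
      range (spectral_projection B `]lambda, +oo[%classic) =
        graph1 (fun y => - adjoint X y))).
Proof.
move=> B.
have bA0 : blin A0 by apply: continuous_blin => //; exact: linearP.
have bA1 : blin A1 by apply: continuous_blin => //; exact: linearP.
have bV : blin V by apply: continuous_blin => //; exact: linearP.
have sA0 := self_adjoint_rsa A0_self_adjoint.
have sA1 := self_adjoint_rsa A1_self_adjoint.
have A0_le := sup_spec_form A0_bounded A0_self_adjoint le_lambda.
have A1_ge := inf_spec_form A1_bounded A1_self_adjoint lambda_le.
have contr (Y : H0 -> H1) : (forall x, `|Y x| <= `|x|) -> forall x, nrm (Y x) <= nrm x.
  by move=> h x; rewrite -lecR -!normE.
have contr_blin (Y : {linear H0 -> H1}) : contractive_solution A0 A1 V Y -> blin Y.
  by case=> /contr h _; split; [exact: linearP|exists 1 => // x; rewrite mul1r].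
have bX := contr_blin X X_sol.
have [/contr cX ricX] := X_sol.
have bB := blin_block bA0 bA1 bV; have sB := rsa_block sA0 sA1 bV.
have hF := spectral_projectionP bB sB.
have eigP := opabs_eigenvalue1 bX cX.
have strict_of : (forall x, adjoint X (X x) = x -> x = 0) -> strict_contraction X.
  by move=> h x x0; rewrite !normE ltcR; exact: not_isometric_strict.
have strict_nrm : strict_contraction X -> forall x, x != 0 -> nrm (X x) < nrm x.
  by move=> h x /h; rewrite !normE ltcR.
have [Q [hQ GQ QG kerQ]] := graph_projection bX.
have rangeQ : range Q = graph0 X.
  apply/seteqP; split=> z; first by case=> w _ <-; apply/graph0P.
  by case=> x _ <-; exists (x, X x).
have rangeE D : (forall z, Q z = spectral_projection B D z) ->
    range (spectral_projection B D) = graph0 X.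
  by move=> QF; rewrite -rangeQ; have <- : Q = spectral_projection B D by exact/funext.
have range_le : (forall z, Q z = spectral_projection B `]-oo, lambda]%classic z) ->
    range (spectral_projection B `]lambda, +oo[%classic) = graph1 (fun y => - adjoint X y).
  move=> QF.
  have mD : measurable (`]-oo, lambda]%classic : set R) by exact: measurable_itv.
  have FE z : spectral_projection B `]lambda, +oo[%classic z = z - Q z.
    by rewrite QF -(spectralC hF)// setCitvl.
  apply/seteqP; split=> z.
    case=> w _ <-; rewrite FE; exists (w - Q w).2 => //.
    have /kerQ <- : Q (w - Q w) = 0.
      by rewrite (blinB (oproj_blin hQ)) (oproj_idem hQ) subrr.
    by case: (w - Q w).
  case=> y _ <-; exists (- adjoint X y, y) => //; rewrite FE.
  have -> : Q (- adjoint X y, y) = 0 by apply/kerQ.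
  by rewrite subr0.
have forward : unique_contractive_solution A0 A1 V X ->
    (forall x, adjoint X (X x) = x -> x = 0) /\
    ((forall z, Q z = spectral_projection B `]-oo, lambda[%classic z) \/
     (forall z, Q z = spectral_projection B `]-oo, lambda]%classic z)).
  case=> _ uniqueX.
  have uX Y : blin Y -> (forall x, nrm (Y x) <= nrm x) ->
      (forall x, riccati A0 A1 V Y x) -> forall x, Y x = X x.
    move=> [lY _] cY ricY.
    pose Y' : {linear H0 -> H1} := HB.pack Y (GRing.isLinear.Build _ _ _ _ Y lY).
    apply: (uniqueX Y'); split => // x.
    by rewrite !normE lecR cY.
  have noiso n := unique_not_isometric bA0 bA1 bV sA0 sA1 A0_le A1_ge bX cX ricX uX (n := n).
  split => //.
  have strictX := strict_nrm (strict_of noiso).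
  have [K0|K1] := unique_dichotomy lambda bA0 bA1 bV sA0 sA1 bX cX ricX uX.
    left; exact: (graph_spectral_lt bA0 bA1 bV sA0 sA1 A0_le A1_ge bX ricX strictX hQ GQ QG kerQ K0).
  right; exact: (graph_spectral_le bA0 bA1 bV sA0 sA1 A0_le A1_ge bX ricX strictX hQ GQ QG kerQ K1).
split; last first.
  move=> /forward[noiso QF]; split; first exact: strict_of.
  by case: QF => QF; [left; exact: rangeE|right; exact: range_le].
split=> [/forward[noiso QF]|[GX /eigP noeig]].
  split; last by move/eigP => [x x0 /noiso x00]; move/eqP: x0; apply.
  case: QF => /rangeE <-.
    by exists `]-oo, lambda[%classic.
  by exists `]-oo, lambda]%classic.
have noiso x : adjoint X (X x) = x -> x = 0.
  by move=> h; apply/eqP/negPn/negP => x0; apply: noeig; exists x.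
have strictX := strict_nrm (strict_of noiso).
split=> // Y Y_sol x; have [/contr cY ricY] := Y_sol.
exact: (spectral_graph_unique bA0 bA1 bV sA0 sA1 bX (contr_blin Y Y_sol) strictX cY GX ricY).
Qed.
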